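(* Let $G$ be non-deterministic and $v\ge0$. For each $n$, let $\gamma^n(v)$ be a semi-directed, non-self-intersecting geodesic from the origin to $(n,\lceil vn\rceil)$, chosen by a fixed deterministic rule. Then almost surely \[\partial^+\Lambda(v)\le\liminf_{n\to\infty}\frac1n\big(U(\gamma^n(v))+R(\gamma^n(v))-D(\gamma^n(v))\big)\] and \[\partial^-\Lambda(v)\ge\limsup_{n\to\infty}\frac1n\big(U(\gamma^n(v))-R(\gamma^n(v))-D(\gamma^n(v))\big).\]
   Context: Model: Let $G$ be a probability measure on $[0,\infty)$. In $\mathbb Z^2$, every vertical edge receives weight $1$ and every horizontal edge (joining $(x,y)$ and $(x+1,y)$) receives an independent random weight with law $G$. A path is a sequence $(z_0,z_1,\dots)$ of points with consecutive points adjacent; its passage time $T(p)$ is the sum of weights over edges $(z_k,z_{k+1})$ of $p$; $T(u,w)=\inf_pT(p)$ over paths from $u$ to $w$, and a path attaining it is a geodesic. A path is semi-directed if $z_{k+1}-z_k\in\{(1,0),(0,1),(0,-1)\}$ for all $k$. For $v\ge 0$, $\Lambda(v)=\lim_n\frac1nT((0,0),(n,\lceil vn\rceil))$ (exists a.s., deterministic, convex); extend to $\mathbb R$ by $\Lambda(-v)=\Lambda(v)$, giving a convex function with one-sided derivatives $\partial^+\Lambda(v)=\lim_{w\searrow v}\frac{\Lambda(w)-\Lambda(v)}{w-v}$ and $\partial^-\Lambda(v)=\lim_{w\nearrow v}\frac{\Lambda(v)-\Lambda(w)}{v-w}$. Pioneer points: for a semi-directed path $p$ from the origin to $(n,m)$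 and $k=0,\dots,n$, let $f_p(k)\in\mathbb Z$ be such that $(k,f_p(k))$ is the first point of $p$ on the line $\{k\}\times\mathbb Z$ (so $f_p(0)=0$), and set $f_p(n+1)=m$. Define $R(p)=|\{k\in\{0,\dots,n\}: f_p(k)=f_p(k+1)\}|$, $U(p)=|\{k\in\{0,\dots,n\}: f_p(k)<f_p(k+1)\}|$, $D(p)=|\{k\in\{0,\dots,n\}: f_p(k)>f_p(k+1)\}|$. *)

(* Defs.v *)
From HB Require Import structures.
From mathcomp Require Import all_boot all_order all_algebra.
From mathcomp Require Import all_classical all_reals all_analysis.
Set Implicit Arguments. Unset Strict Implicit. Unset Printing Implicit Defensive.
Import Order.TTheory GRing.Theory Num.Theory.
Import numFieldNormedType.Exports.
Local Open Scope classical_set_scope.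
Local Open Scope ring_scope.

Definition pt2 := (int * int)%type.

Definition adj (a b : pt2) : bool := (`|a.1 - b.1|%N + `|a.2 - b.2|%N == 1)%N.

Definition is_path (u v : pt2) (p : seq pt2) : bool :=
  match p with
  | [::] => false
  | a :: q => [&& a == u, path adj a q & last a q == v]
  end.

(* Weight of the edge {a,b} (a, b adjacent): vertical edges weigh 1, the
   horizontal edge joining (x,y) and (x+1,y) weighs w (x,y). *)
Definition edge_wt (R : realType) (w : pt2 -> R) (a b : pt2) : R :=
  if a.2 == b.2 then w (Order.min a.1 b.1, a.2) else 1.

Definition ptime (R : realType) (w : pt2 -> R) (p : seq pt2) : R :=
  \sum_(ab <- zip p (behead p)) edge_wt w ab.1 ab.2.

Definition Tpass (R : realType) (w : pt2 -> R) (u v : pt2) : R :=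
  inf [set ptime w p | p in [set p | is_path u v p]].

Definition geodesic (R : realType) (w : pt2 -> R) (u v : pt2) (p : seq pt2) :=
  is_path u v p /\ ptime w p = Tpass w u v.

Definition sd_step (a b : pt2) : bool :=
  [|| (b.1 - a.1 == 1) && (b.2 == a.2),
      (b.1 == a.1) && (b.2 - a.2 == 1)
    | (b.1 == a.1) && (b.2 - a.2 == -1)].
Definition semi_directed (p : seq pt2) : bool := sorted sd_step p.

Definition fpio (p : seq pt2) (n : nat) (m : int) (k : nat) : int :=
  if k == n.+1 then m
  else (nth (0, 0) p (find (fun z : pt2 => z.1 == k%:Z) p)).2.

Definition Rcnt (p : seq pt2) (n : nat) (m : int) : nat :=
  count (fun k => fpio p n m k == fpio p n m k.+1) (iota 0 n.+1).
Definition Ucnt (p : seq pt2) (n : nat) (m : int) : nat :=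
  count (fun k => fpio p n m k < fpio p n m k.+1) (iota 0 n.+1).
Definition Dcnt (p : seq pt2) (n : nat) (m : int) : nat :=
  count (fun k => fpio p n m k > fpio p n m k.+1) (iota 0 n.+1).

Definition endpt (R : realType) (v : R) (n : nat) : pt2 :=
  (n%:Z, Num.ceil (v * n%:R)).

Definition mutually_indep d (Omega : measurableType d) (R : realType)
    (P : probability Omega R) (I : eqType) (X : I -> {RV P >-> R}) : Prop :=
  forall (J : seq I) (A : I -> set R), uniq J -> (forall i, measurable (A i)) ->
    P (\bigcap_(i in [set i | i \in J]) (X i @^-1` A i)) =
    (\prod_(i <- J) P (X i @^-1` A i))%E.

(* Lambda(v) for v >= 0: the (a.s., deterministic) limit of
   T((0,0),(n,ceil(vn)))/n; extended evenly to R. *)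
Definition Lambda0 d (Omega : measurableType d) (R : realType)
    (P : probability Omega R) (w : pt2 -> {RV P >-> R}) (v : R) : R :=
  xget 0 [set l : R | {ae P, forall om,
     (fun n : nat => Tpass (fun e => w e om) (0, 0) (endpt v n) / n%:R)
       @ \oo --> l}].

Definition Lambda d (Omega : measurableType d) (R : realType)
    (P : probability Omega R) (w : pt2 -> {RV P >-> R}) (v : R) : R :=
  Lambda0 w `|v|.

Definition dplus (R : realType) (L : R -> R) (v : R) : R :=
  lim ((fun x => (L x - L v) / (x - v)) @ v^'+).
Definition dminus (R : realType) (L : R -> R) (v : R) : R :=
  lim ((fun x => (L v - L x) / (v - x)) @ v^'-).

(* Main.v *)
(** The passage time [T] from the origin to [(n, m)] is the minimum, over the
    heights [h_0, ..., h_(n-1)] of the horizontal edges of a semi-directed path,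
    of the sum of their weights plus the total vertical variation.  Replacing one
    column of weights costs at most a vertical detour to a cheap edge, whose
    length has geometric tails, so the Efron-Stein inequality gives a variance of
    order [n] and [T] concentrates around a number [a n m] that depends only on
    the law [G].  Subadditivity (up to errors of order [sqrt n]) and Borel-Cantelli
    along squares then yield the time constant [lam], which is even, convex and
    1-Lipschitz, and is the same for every i.i.d. environment of law [G].

    Now shear the environment, [w'(x, y) = w(x, y - (x + 1))].  It is again i.i.d.,
    and the sheared geodesic is a path to [(n, m + n + 1)] whose passage time
    exceeds [T] by the sum over [k] of [|f(k+1) - f(k) + 1| - |f(k+1) - f(k)|],
    which is [U + R - D].  Hence [lam (v + 1) - lam v] is at most the lower limit
    of [(U + R - D) / n], and by convexity the right derivative is at most
    [lam (v + 1) - lam v].  The opposite shear gives the second inequality. *)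
Require Import Defs.
From HB Require Import structures.
From mathcomp Require Import all_boot all_order all_algebra.
From mathcomp Require Import all_classical all_reals all_analysis.
From mathcomp Require Import ring lra zify.
Import Order.TTheory GRing.Theory Num.Theory.
Import numFieldNormedType.Exports.
Local Open Scope classical_set_scope.
Local Open Scope ring_scope.

Set Implicit Arguments.
Unset Strict Implicit.
Unset Printing Implicit Defensive.

(** * Variance on finite product spaces *)

(** No moment of [G] is assumed, and [Smin] is an infimum over infinitely many profiles.
    Expectations are therefore taken only over truncated columns with finitely many values, where
    they are finite sums; [a n m] is the mean of the truncated passage time. Concentration then
    removes expectations from the argument: an inequality between passage times in several
    environments becomes one between values of [a] as soon as an outcome typical for all of them is
    picked. At a linear scale the deviation bound is only of order [1 / n], which is not summable;
    it becomes so along squares, and monotonicity in the column fills the gaps. *)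

Section FiniteProduct.
Variables (R : realFieldType) (V : finType) (rho : V -> R).
Hypothesis rho_ge0 : forall a, 0 <= rho a.
Hypothesis rho_sum1 : \sum_a rho a = 1.

(** Expectation over [n] independent letters of law [rho], conditioning on the first letter. Words
    are plain sequences, so that one coordinate is singled out as [p ++ a :: s]. *)
Fixpoint Ex (n : nat) (f : seq V -> R) : R :=
  if n is n'.+1 then \sum_a rho a * Ex n' (fun s => f (a :: s)) else f [::].

Lemma eq_Ex n f g : (forall s, size s = n -> f s = g s) -> Ex n f = Ex n g.
Proof.
elim: n f g => [|n IH] f g fg /=; first exact: fg.
by apply: eq_bigr => a _; congr (_ * _); apply: IH => s sn; apply: fg; rewrite /= sn.
Qed.

Lemma le_Ex n f g : (forall s, size s = n -> f s <= g s) -> Ex n f <= Ex n g.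
Proof.
elim: n f g => [|n IH] f g fg /=; first exact: fg.
apply: ler_sum => a _; apply: ler_wpM2l => //.
by apply: IH => s sn; apply: fg; rewrite /= sn.
Qed.

Lemma Ex_cst n c : Ex n (fun=> c) = c.
Proof. by elim: n => //= n IH; rewrite IH -mulr_suml rho_sum1 mul1r. Qed.

Lemma ExD n f g : Ex n (fun s => f s + g s) = Ex n f + Ex n g.
Proof.
elim: n f g => //= n IH f g; rewrite -big_split /=.
by apply: eq_bigr => a _; rewrite IH mulrDr.
Qed.

Lemma ExZ n c f : Ex n (fun s => c * f s) = c * Ex n f.
Proof.
elim: n f => //= n IH f; rewrite mulr_sumr.
by apply: eq_bigr => a _; rewrite IH mulrCA.
Qed.

Lemma Ex_sum n (F : V -> seq V -> R) :
  Ex n (fun s => \sum_a F a s) = \sum_a Ex n (F a).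
Proof.
elim: n F => //= n IH F; rewrite exchange_big /=.
by apply: eq_bigr => a _; rewrite IH mulr_sumr.
Qed.

Lemma Ex_var n f c :
  Ex n (fun s => (f s - c) ^+ 2) = Ex n (fun s => f s ^+ 2) - 2 * c * Ex n f + c ^+ 2.
Proof.
rewrite -[c ^+ 2 in RHS](Ex_cst n) -mulNr -ExZ -!ExD.
by apply: eq_Ex => s _; ring.
Qed.

Lemma Ex_sqr_le n f : (Ex n f) ^+ 2 <= Ex n (fun s => f s ^+ 2).
Proof.
have : 0 <= Ex n (fun s => (f s - Ex n f) ^+ 2).
  by rewrite -(Ex_cst n 0); apply: le_Ex => s _; exact: sqr_ge0.
rewrite Ex_var; set u := Ex n f; set w := Ex n _; nra.
Qed.

Lemma Ex_ge0 n f : (forall s, size s = n -> 0 <= f s) -> 0 <= Ex n f.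
Proof. by move=> f0; rewrite -(Ex_cst n 0); apply: le_Ex. Qed.

Lemma Ex_chebyshev n (f : seq V -> R) (c t : R) : 0 < t ->
  Ex n (fun s => (t < `|f s - c|)%R%:R) <= Ex n (fun s => (f s - c) ^+ 2) / t ^+ 2.
Proof.
move=> t0; rewrite [leRHS]mulrC -ExZ; apply: le_Ex => s _.
have [h|h] := ltP; last by rewrite mulr_ge0 ?sqr_ge0// invr_ge0 sqr_ge0.
rewrite mulrC ler_pdivlMr ?exprn_gt0// mul1r -[leRHS]real_normK ?num_real//.
by rewrite lerXn2r ?nnegrE ?normr_ge0// ltW.
Qed.

(** Only increases are measured: a detour bounds the increase of the passage time in terms of the
    new column alone, whatever the old one was. *)
Definition posd (x y : R) := Num.max 0 (x - y).

Lemma posd_ge0 x y : 0 <= posd x y.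
Proof. by rewrite /posd le_max lexx. Qed.

Lemma sqr_posd x y : (x - y) ^+ 2 = posd x y ^+ 2 + posd y x ^+ 2.
Proof. by rewrite /posd; case: (leP 0 (x - y)); case: (leP 0 (y - x)) => ? ?; nra. Qed.

Lemma posd_Ex n f g :
  posd (Ex n f) (Ex n g) ^+ 2 <= Ex n (fun s => posd (f s) (g s) ^+ 2).
Proof.
apply: (le_trans _ (Ex_sqr_le _ _)).
have E0 : 0 <= Ex n (fun s => posd (f s) (g s)).
  by apply: Ex_ge0 => s _; exact: posd_ge0.
rewrite ler_sqr ?nnegrE ?posd_ge0// {1}/posd ge_max E0 /=.
rewrite -mulN1r -ExZ -ExD; apply: le_Ex => s _; rewrite mulN1r.
by rewrite /posd le_max lexx orbT.
Qed.

(** Induction on the first letter: the variance is the mean of the conditional variances plus the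
    variance of the conditional mean [m']. The old letter [a] is arbitrary and only the new letter
    [b] is averaged, which is why [posd] suffices. *)
Lemma efron_stein n (f : seq V -> R) (C : R) :
  (forall p a s, (size p + (size s).+1)%N = n ->
     \sum_b rho b * posd (f (p ++ b :: s)) (f (p ++ a :: s)) ^+ 2 <= C) ->
  Ex n (fun s => (f s - Ex n f) ^+ 2) <= 2 * n%:R * C.
Proof.
elim: n f => [|n IH] f fC /=; first by rewrite subrr expr0n /= mulr0 mul0r.
pose m' a := Ex n (fun s => f (a :: s)).
pose m := \sum_a rho a * m' a; rewrite -/m.
have step a : Ex n (fun s => (f (a :: s) - m) ^+ 2) <=
    2 * n%:R * C + (m' a - m) ^+ 2.
  have := IH (fun s => f (a :: s)).
  move=> /(_ (fun p b s pn => fC (a :: p) b s (congr1 succn pn))).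
  rewrite -/(m' a) !Ex_var -/(m' a); set u := Ex n _; lra.
(* [m] is the average of [m' b]. Jensen, in place of the exact variance identity, costs the factor 2
   in the conclusion. *)
have jensen a : (m' a - m) ^+ 2 <= \sum_b rho b * (m' a - m' b) ^+ 2.
  have := Ex_sqr_le 1 (fun s => if s is b :: _ then m' a - m' b else 0).
  rewrite /=; under eq_bigr do rewrite mulrBr.
  by rewrite sumrB -mulr_suml rho_sum1 mul1r.
apply: (@le_trans _ _ (\sum_a rho a * (2 * n%:R * C + \sum_b rho b * (m' a - m' b) ^+ 2))).
  apply: ler_sum => a _; apply: ler_wpM2l => //.
  by apply: le_trans (step a) _; rewrite lerD2l.
under eq_bigr do rewrite mulrDr.
rewrite big_split /= -mulr_suml rho_sum1 mul1r.
have -> : n.+1%:R = n%:R + 1 :> R by rewrite natr1.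
suff : \sum_a rho a * (\sum_b rho b * (m' a - m' b) ^+ 2) <= 2 * C by lra.
have bnd : \sum_a rho a * (\sum_b rho b * posd (m' b) (m' a) ^+ 2) <= C.
  rewrite -[leRHS]mul1r -rho_sum1 mulr_suml.
  apply: ler_sum => a _; apply: ler_wpM2l => //.
  apply: (@le_trans _ _ (Ex n (fun s => \sum_b rho b * posd (f (b :: s)) (f (a :: s)) ^+ 2))).
    rewrite Ex_sum; apply: ler_sum => b _; rewrite ExZ; apply: ler_wpM2l => //.
    exact: posd_Ex.
  rewrite -(Ex_cst n C); apply: le_Ex => s sn; apply: (fC [::]).
  by rewrite /= sn.
(* Each square splits into two positive parts, which exchange under the symmetry between [a] and
   [b]. *)
suff -> : \sum_a rho a * (\sum_b rho b * (m' a - m' b) ^+ 2) =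
   \sum_a rho a * (\sum_b rho b * posd (m' b) (m' a) ^+ 2) +
   \sum_a rho a * (\sum_b rho b * posd (m' b) (m' a) ^+ 2) by lra.
transitivity (\sum_a \sum_b (rho a * (rho b * posd (m' a) (m' b) ^+ 2) +
                           rho a * (rho b * posd (m' b) (m' a) ^+ 2))).
  apply: eq_bigr => a _; rewrite mulr_sumr; apply: eq_bigr => b _.
  by rewrite sqr_posd !mulrDr.
under eq_bigr do rewrite big_split /=.
rewrite big_split /=; congr (_ + _).
  rewrite exchange_big /=; apply: eq_bigr => a _; rewrite mulr_sumr.
  by apply: eq_bigr => b _; rewrite mulrCA.
by apply: eq_bigr => a _; rewrite mulr_sumr.
Qed.
End FiniteProduct.

(** * Passage times as minima over height profiles *)

Section Heights.
Variable R : realType.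
Implicit Types (w : pt2 -> R) (hs : seq int) (x y m : int).

Definition idist (a b : int) : R := (`|a - b|)%:~R.

Lemma idist_ge0 a b : 0 <= idist a b.
Proof. by rewrite /idist ler0z normr_ge0. Qed.

Lemma idistxx a : idist a a = 0.
Proof. by rewrite /idist subrr normr0. Qed.

Lemma idistC a b : idist a b = idist b a.
Proof. by rewrite /idist distrC. Qed.

Lemma idist_trans b a c : idist a c <= idist a b + idist b c.
Proof. by rewrite /idist -intrD ler_int ler_distD. Qed.

(* [hs] lists the heights of the horizontal edges of a semi-directed path from
   [(x, y)] to [(x + size hs, m)]. *)
Fixpoint hcost w x y hs m : R :=
  if hs is h :: hs' then idist h y + w (x, h) + hcost w (x + 1) h hs' m
  else idist m y.

Lemma addr1Sz x (k : nat) : x + 1 + k%:Z = x + k.+1%:Z.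
Proof. lia. Qed.

Lemma hcost_rcons w x y hs h m : hcost w x y (rcons hs h) m =
  hcost w x y hs h + w (x + (size hs)%:Z, h) + idist m h.
Proof.
elim: hs x y => [|h' hs IH] x y /=; first by rewrite addr0.
by rewrite IH addr1Sz !addrA.
Qed.

Lemma hcost_lip w x y hs m m' : hcost w x y hs m' <= hcost w x y hs m + idist m' m.
Proof.
elim: hs x y => [|h hs IH] x y /=; first by have := idist_trans m m' y; lra.
by have := IH (x + 1) h; lra.
Qed.

Lemma hcost_lipl w x y y' hs m : hcost w x y hs m <= idist y y' + hcost w x y' hs m.
Proof.
case: hs => [|h hs] /=; first by have := idist_trans y' m y; rewrite (idistC y' y); lra.
by have := idist_trans y' h y; rewrite (idistC y' y); lra.
Qed.

Lemma hcost_cat w x y hs1 m1 hs2 m2 : hcost w x y (hs1 ++ hs2) m2 <=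
  hcost w x y hs1 m1 + hcost w (x + (size hs1)%:Z) m1 hs2 m2.
Proof.
elim: hs1 x y => [|h hs IH] x y /=.
  by rewrite addr0 (idistC m1); exact: hcost_lipl.
by have := IH (x + 1) h; rewrite addr1Sz; lra.
Qed.

Lemma hcost_shift w x y a b hs m :
  hcost (fun e => w (e.1 + a, e.2 + b)) x y hs m =
  hcost w (x + a) (y + b) [seq h + b | h <- hs] (m + b).
Proof.
have d c e : idist (c + b) (e + b) = idist c e.
  by rewrite /idist; congr (`|_|%:~R); lia.
elim: hs x y => [|h hs IH] x y /=; first by rewrite d.
by rewrite d IH [x + 1 + a]addrAC.
Qed.

Lemma hcost_opp w x y hs m :
  hcost (fun e => w (e.1, - e.2)) x y hs m =
  hcost w x (- y) [seq - h | h <- hs] (- m).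
Proof.
have d c e : idist (- c) (- e) = idist c e.
  by rewrite /idist -opprD normrN.
by elim: hs x y => [|h hs IH] x y /=; rewrite d // IH.
Qed.

Definition wnneg w := forall e, 0 <= w e.

Lemma hcost_ge w x y hs m : wnneg w -> idist m y <= hcost w x y hs m.
Proof.
move=> w0; elim: hs x y => [|h hs IH] x y //=.
have := IH (x + 1) h; have := idist_trans h m y; have := w0 (x, h); lra.
Qed.

Lemma hcost_ge0 w x y hs m : wnneg w -> 0 <= hcost w x y hs m.
Proof. by move=> w0; apply: le_trans (idist_ge0 _ _) (hcost_ge _ _ _ _ w0). Qed.

Lemma hcost_belast w x y hs h m : wnneg w ->
  hcost w x y hs m <= hcost w x y (rcons hs h) m.
Proof.
move=> w0; rewrite hcost_rcons.
have := hcost_lip w x y hs h m; have := w0 (x + (size hs)%:Z, h); lra.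
Qed.

(** The edge leaving the [k]-th column lies at height [F k.+1], where the next column is entered;
    the last variation is the vertical end piece. *)
Lemma hcost_sum w x (F : nat -> int) n :
  hcost w x (F 0) [seq F k | k <- iota 1 n] (F n.+1) =
  \sum_(k < n) w (x + k%:Z, F k.+1) + \sum_(k < n.+1) idist (F k.+1) (F k).
Proof.
elim: n x F => [|n IH] x F; first by rewrite big_ord0 big_ord1 add0r.
rewrite [in RHS]big_ord_recl [X in _ = _ + X]big_ord_recl /= addr0.
have -> : [seq F k | k <- iota 2 n] = [seq (fun k => F k.+1) k | k <- iota 1 n].
  by rewrite -[2%N]/(1 + 1)%N iotaDl -map_comp.
rewrite (IH _ (fun k => F k.+1)).
set A := \sum_(i < n) _; set A' := \sum_(i < n) _.
suff -> : A = A' by ring.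
by apply: eq_bigr => i _; rewrite /bump /= add1n addr1Sz.
Qed.

Definition Smin w (n : nat) m : R :=
  inf [set hcost w 0 0 hs m | hs in [set hs : seq int | size hs = n]].

Section Nonneg.
Variable w : pt2 -> R.
Hypothesis w0 : wnneg w.

Lemma Smin_le n m hs : size hs = n -> Smin w n m <= hcost w 0 0 hs m.
Proof.
move=> hsn; apply: ge_inf; last by exists hs.
by exists 0 => _ [hs' _ <-]; exact: hcost_ge0.
Qed.

Lemma Smin_ge n m c :
  (forall hs, size hs = n -> c <= hcost w 0 0 hs m) -> c <= Smin w n m.
Proof.
move=> h; apply: lb_le_inf; first by exists (hcost w 0 0 (nseq n 0) m), (nseq n 0) => //=; rewrite size_nseq.
by move=> _ [hs hsn <-]; exact: h.
Qed.

Lemma Smin_ge0 n m : 0 <= Smin w n m.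
Proof. by apply: Smin_ge => hs _; exact: hcost_ge0. Qed.

Lemma Smin_lip n m m' : Smin w n m' <= Smin w n m + idist m' m.
Proof.
rewrite -lerBlDr; apply: Smin_ge => hs hsn; rewrite lerBlDr.
exact: le_trans (Smin_le _ hsn) (hcost_lip _ _ _ _ _ _).
Qed.

(** Deleting the last horizontal edge of a profile saves a nonnegative weight, and by the triangle
    inequality the vertical part does not grow. *)
Lemma Smin_mono n k m : Smin w n m <= Smin w (n + k) m.
Proof.
elim: k => [|k IH]; first by rewrite addn0.
apply: le_trans IH _; rewrite addnS; apply: Smin_ge => hs.
case/lastP: hs => // hs h; rewrite size_rcons => -[hsn].
exact: le_trans (Smin_le _ hsn) (hcost_belast _ _ _ _ _ w0).
Qed.

End Nonneg.

Definition wshift (a b : int) w : pt2 -> R := fun e => w (e.1 + a, e.2 + b).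
Definition wopp w : pt2 -> R := fun e => w (e.1, - e.2).

Lemma Smin_triangle w n1 n2 m1 m2 : wnneg w ->
  Smin w (n1 + n2) (m1 + m2) <= Smin w n1 m1 + Smin (wshift n1%:Z m1 w) n2 m2.
Proof.
move=> w0; rewrite -lerBlDl; apply: Smin_ge => hs2 hs2n; rewrite lerBlDl -lerBlDr; apply: Smin_ge => // hs1 hs1n.
rewrite lerBlDr /wshift hcost_shift !add0r [m2 + _]addrC.
apply: le_trans (Smin_le w0 (hs := hs1 ++ [seq h + m1 | h <- hs2]) _ _) _.
  by rewrite size_cat size_map hs1n hs2n.
by apply: le_trans (hcost_cat _ _ _ _ m1 _ _) _; rewrite hs1n add0r.
Qed.

Lemma Smin_opp w n m : wnneg w -> Smin (wopp w) n m <= Smin w n (- m).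
Proof.
move=> w0; apply: Smin_ge => // hs hsn.
have w0' : wnneg (wopp w) by move=> e; exact: w0.
apply: le_trans (Smin_le w0' (hs := [seq - h | h <- hs]) _ _) _.
  by rewrite size_map.
rewrite /wopp hcost_opp oppr0 -map_comp (eq_map (g := id)) ?map_id//.
by move=> h /=; rewrite opprK.
Qed.

Lemma ptime_cons w a b q : ptime w (a :: b :: q) = edge_wt w a b + ptime w (b :: q).
Proof. by rewrite /ptime /= big_cons. Qed.

Lemma ptime1 w a : ptime w [:: a] = 0.
Proof. by rewrite /ptime /= big_nil. Qed.

Lemma ptime_cat w a q1 q2 :
  ptime w (a :: q1 ++ q2) = ptime w (a :: q1) + ptime w (last a q1 :: q2).
Proof.
elim: q1 a => [|b q1 IH] a /=; first by rewrite ptime1 add0r.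
by rewrite !ptime_cons IH addrA.
Qed.

Lemma edge_wt_ge0 w a b : wnneg w -> 0 <= edge_wt w a b.
Proof. by move=> w0; rewrite /edge_wt; case: ifP. Qed.

Lemma ptime_ge0 w p : wnneg w -> 0 <= ptime w p.
Proof. by move=> w0; rewrite /ptime sumr_ge0 // => i _; exact: edge_wt_ge0. Qed.

Lemma vertical_path w x y h : exists q,
  [/\ path adj (x, y) q, last (x, y) q = (x, h) & ptime w ((x, y) :: q) = idist h y].
Proof.
have [k [->|->]] : exists k : nat, h = y + k%:Z \/ h = y - k%:Z.
- by exists `|h - y|%N; lia.
- elim: k y => [|k IH] y; first by exists [::]; rewrite ptime1 addr0 idistxx.
  have [q [pq lq tq]] := IH (y + 1); exists ((x, y + 1) :: q); split => /=.
  + by rewrite pq andbT /adj /=; lia.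
  + by rewrite lq addr1Sz.
  + rewrite ptime_cons tq /edge_wt /= ifF; last by lia.
    by rewrite /idist -[1]/(1%:~R) -intrD; congr (_%:~R); lia.
- elim: k y => [|k IH] y; first by exists [::]; rewrite ptime1 subr0 idistxx.
  have [q [pq lq tq]] := IH (y - 1); exists ((x, y - 1) :: q); split => /=.
  + by rewrite pq andbT /adj /=; lia.
  + by rewrite lq; congr (_, _); lia.
  + rewrite ptime_cons tq /edge_wt /= ifF; last by lia.
    by rewrite /idist -[1]/(1%:~R) -intrD; congr (_%:~R); lia.
Qed.

Lemma hcost_path w x y hs m : exists q,
  [/\ path adj (x, y) q, last (x, y) q = (x + (size hs)%:Z, m)
    & ptime w ((x, y) :: q) = hcost w x y hs m].
Proof.
elim: hs x y => [|h hs IH] x y; first by rewrite addr0; exact: vertical_path.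
have [q1 [p1 l1 t1]] := vertical_path w x y h.
have [q2 [p2 l2 t2]] := IH (x + 1) h.
exists (q1 ++ (x + 1, h) :: q2); split.
- by rewrite cat_path p1 l1 /= p2 andbT /adj /=; lia.
- by rewrite last_cat /= l2 addr1Sz.
rewrite ptime_cat t1 l1 ptime_cons t2 /= /edge_wt /= eqxx.
have -> : Order.min x (x + 1) = x by lia.
by rewrite addrA.
Qed.

(** Arbitrary paths reduce to height profiles by following the path step by step: a vertical step
    moves the endpoint, a step to the right appends a height, a step to the left deletes the last
    one. Columns left of the origin carry the empty profile, hence [Num.max 0]. *)
Lemma path_hcost w q : wnneg w -> path adj (0, 0) q ->
  let e := last ((0, 0) : pt2) q in
  exists hs, size hs = `|Num.max 0%R e.1|%N /\
    hcost w 0 0 hs e.2 <= ptime w ((0, 0) :: q).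
Proof.
move=> w0; elim/last_ind: q => [_|q z IH].
  by exists [::]; rewrite /= idistxx ptime1.
rewrite rcons_path last_rcons => /andP[/IH /= [hs [hsn hsle]]].
rewrite -cats1 ptime_cat ptime_cons ptime1 addr0.
set e := last _ _ in hsn hsle *; set t := ptime _ _ in hsle *.
case: e hsn hsle => a b /=; case: z => a' b'; rewrite /adj /= => hsn hsle ab.
have [[Ea Eb]|[-> [Ea|Ea]]] : (a' = a /\ `|b' - b| = 1) \/
  (b' = b /\ (a' = a + 1 \/ a = a' + 1)) by lia.
- exists hs; split; first by rewrite Ea.
  rewrite /edge_wt /= ifF; last by lia.
  have := hcost_lip w 0 0 hs b b'; rewrite [idist b' b]/idist Eb; lra.
- have ew := edge_wt_ge0 (a, b) (a', b) w0.
  have [a0|a0] := leP 0 a; last first.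
    by exists hs; rewrite hsn; split; [lia|lra].
  exists (rcons hs b); rewrite size_rcons hsn; split; first lia.
  rewrite hcost_rcons idistxx /edge_wt /= eqxx hsn.
  have -> : Order.min a a' = a by lia.
  have -> : 0 + `|Num.max 0%R a|%N%:Z = a by lia.
  lra.
- have ew := edge_wt_ge0 (a, b) (a', b) w0.
  have [a0|a0] := leP a 0.
    by exists hs; rewrite hsn; split; [lia|lra].
  case/lastP: hs hsn hsle => [|hs h]; first by rewrite /=; lia.
  rewrite size_rcons => hsn hsle; exists hs; split; first lia.
  have := hcost_belast 0 0 hs h b w0; lra.
Qed.

Lemma TpassE w n m : wnneg w -> Tpass w (0, 0) (n%:Z, m) = Smin w n m.
Proof.
move=> w0; apply/eqP; rewrite eq_le; apply/andP; split.
  apply: Smin_ge => // hs hsn.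
  have [q [pq lq <-]] := hcost_path w 0 0 hs m.
  apply: ge_inf; first by exists 0 => _ [p _ <-]; exact: ptime_ge0.
  by exists ((0, 0) :: q) => //; apply/and3P; split=> //; rewrite lq hsn add0r.
apply: lb_le_inf.
  have [q [pq lq _]] := hcost_path w 0 0 (nseq n 0) m.
  exists (ptime w ((0, 0) :: q)), ((0, 0) :: q) => //.
  by apply/and3P; split=> //; rewrite lq size_nseq add0r.
move=> _ [[|a q] //= /and3P[/eqP -> pq /eqP lq] <-].
have [hs []] := path_hcost w0 pq; rewrite lq /= => hsn.
by apply: le_trans; apply: Smin_le => //; rewrite hsn; lia.
Qed.

Definition first_height (p : seq pt2) (c : int) : int :=
  (nth (0, 0) p (find (fun z : pt2 => z.1 == c) p)).2.

(** Between two first entries the path pays at least the difference of heights; the inequality may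
    be strict because vertical moves inside a column can be wasted. *)
Lemma semi_directed_hcost w a q n m : wnneg w -> semi_directed (a :: q) ->
  last a q = (a.1 + n%:Z, m) ->
  hcost w a.1 a.2 [seq first_height (a :: q) (a.1 + k%:Z) | k <- iota 1 n] m
    <= ptime w (a :: q).
Proof.
move=> w0; rewrite /semi_directed /=.
elim: q a n => [|b q IH] [x y] n /=.
  move=> _ [xn <-]; rewrite ptime1.
  have -> : n = 0%N by lia.
  by rewrite /= idistxx.
move=> /andP[sd pq] lq; rewrite ptime_cons.
have fhS c : c != x -> first_height ((x, y) :: b :: q) c = first_height (b :: q) c.
  by move=> cx; rewrite {1}/first_height /= eq_sym (negbTE cx).
(* A vertical step leaves the entry heights of later columns unchanged and moves the start by one
   unit, the price of the edge. *)
have vert : b.1 = x -> `|b.2 - y| = 1 -> hcost w x y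
    [seq first_height ((x, y) :: b :: q) (x + k%:Z) | k <- iota 1 n] m <=
    edge_wt w (x, y) b + ptime w (b :: q).
  move=> bx by1; have := IH b n pq; rewrite bx => /(_ lq) h.
  have -> : [seq first_height ((x, y) :: b :: q) (x + k%:Z) | k <- iota 1 n] =
     [seq first_height (b :: q) (x + k%:Z) | k <- iota 1 n].
    by apply/eq_in_map => k; rewrite mem_iota => hk; apply: fhS; lia.
  rewrite /edge_wt /= ifF; last by lia.
  apply: le_trans (hcost_lipl _ _ y b.2 _ _) _.
  by rewrite {1}/idist distrC by1; lra.
have mono : forall (c : pt2) s, path sd_step c s -> c.1 <= (last c s).1.
  move=> c s; elim: s c => [|c' s IHs] c //= /andP[sc /IHs].
  by move: sc; rewrite /sd_step; lia.
case/or3P: sd => /= /andP[/eqP s1 /eqP s2]; last 2 first.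
- by apply: vert; lia.
- by apply: vert; lia.
case: n lq {vert} => [|n] lq.
  by have := mono _ _ pq; rewrite lq /=; lia.
have bE : b = (x + 1, y) by case: (b) s1 s2 => b1 b2 /= ? ->; congr (_, _); lia.
have := IH b n pq; rewrite lq bE /= addr1Sz => /(_ erefl) h.
rewrite bE in fhS *.
have -> : [seq first_height ((x, y) :: (x + 1, y) :: q) (x + k%:Z) | k <- iota 2 n] =
     [seq first_height ((x + 1, y) :: q) (x + 1 + k%:Z) | k <- iota 1 n].
  rewrite -[2%N]/(1 + 1)%N iotaDl -map_comp; apply/eq_in_map => k _ /=.
  by rewrite add1n -addr1Sz; apply: fhS; lia.
have -> : first_height ((x, y) :: (x + 1, y) :: q) (x + 1%:Z) = y.
  by rewrite fhS; [rewrite /first_height /= eqxx|lia].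
rewrite idistxx /edge_wt /= eqxx.
have -> : Order.min x (x + 1) = x by lia.
lra.
Qed.

Lemma fpioE p n m k : (k <= n)%N -> fpio p n m k = first_height p k%:Z.
Proof. by move=> kn; rewrite /fpio ifF //; lia. Qed.

Lemma geodesic_hcost w p n m : wnneg w -> semi_directed p -> is_path (0, 0) (n%:Z, m) p ->
  \sum_(k < n) w (k%:Z, fpio p n m k.+1) +
  \sum_(k < n.+1) idist (fpio p n m k.+1) (fpio p n m k) <= ptime w p.
Proof.
case: p => // a q w0 sd /and3P[/eqP aE pq /eqP lq]; subst a.
have := hcost_sum w 0 (fpio ((0, 0) :: q) n m) n.
under eq_bigr do rewrite add0r.
move=> <-.
have -> : fpio ((0, 0) :: q) n m 0 = 0 by rewrite fpioE.
have -> : fpio ((0, 0) :: q) n m n.+1 = m by rewrite /fpio eqxx.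
have := semi_directed_hcost (n := n) (m := m) w0 sd; rewrite /= lq add0r => /(_ erefl).
apply: le_trans; rewrite le_eqVlt; apply/orP; left; apply/eqP; congr hcost.
apply/eq_in_map => k; rewrite mem_iota => kn; rewrite add0r fpioE//; lia.
Qed.

(** The edge leaving column [x] lies at height [f (x + 1)], which the shear moves by [sg * (x + 1)];
    with this offset the sheared path meets exactly the weights of the original path. *)
Definition wshear (sg : int) w : pt2 -> R := fun e => w (e.1, e.2 - sg * (e.1 + 1)).

(* Adding [sg * k] to the height of the path in column [k] changes only its
   vertical steps, and sheared weights are again i.i.d. *)
Lemma Smin_shear w p (n : nat) m (sg : int) : wnneg w ->
  semi_directed p -> is_path (0, 0) (n%:Z, m) p ->
  Smin (wshear sg w) n (m + sg * n.+1%:Z) <= ptime w p +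
  \sum_(k < n.+1) (idist (fpio p n m k.+1 + sg) (fpio p n m k) -
                   idist (fpio p n m k.+1) (fpio p n m k)).
Proof.
move=> w0 sd pp; set f := fpio p n m.
have f0 : f 0 = 0.
  by rewrite /f fpioE //; case: p pp {sd f} => // a q /and3P[/eqP -> _ _].
have fn : f n.+1 = m by rewrite /f /fpio eqxx.
pose F (k : nat) := f k + sg * k%:Z.
have F0 : F 0 = 0 by rewrite /F f0 mulr0 addr0.
apply: (@le_trans _ _ (hcost (wshear sg w) 0 0 [seq F k | k <- iota 1 n] (F n.+1))).
  rewrite {2}/F fn; apply: Smin_le; first by move=> e; exact: w0.
  by rewrite size_map size_iota.
have := hcost_sum (wshear sg w) 0 F n; rewrite F0 => ->.
apply: le_trans (lerD (geodesic_hcost w0 sd pp) (lexx _)).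
have Sz (k : nat) : k.+1%:Z = k%:Z + 1 by lia.
have -> : \sum_(k < n) wshear sg w (0 + k%:Z, F k.+1) = \sum_(k < n) w (k%:Z, f k.+1).
  by apply: eq_bigr => k _; rewrite /wshear /F [fst _]/= [snd _]/= add0r Sz addrK.
have -> : \sum_(k < n.+1) idist (F k.+1) (F k) = \sum_(k < n.+1) idist (f k.+1 + sg) (f k).
  by apply: eq_bigr => k _; rewrite /F /idist Sz; congr (`|_|%:~R); ring.
rewrite sumrB -/f.
set x := \sum_(k < n) _; set y := \sum_(k < n.+1) _; set z := \sum_(k < n.+1) _; lra.
Qed.

End Heights.

(** * Variance of the truncated passage time *)

Section Box.
Variable R : realType.
Implicit Types (w : pt2 -> R) (hs : seq int) (x y m : int).

Definition inbox (A n : nat) hs := (size hs == n) && all (fun h => `|h| <= A%:Z) hs.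

Definition Sbox (A : nat) w (n : nat) m : R :=
  inf [set hcost w 0 0 hs m | hs in [set hs | inbox A n hs]].

Lemma Sbox_le A w n m hs : wnneg w -> inbox A n hs ->
  Sbox A w n m <= hcost w 0 0 hs m.
Proof.
move=> w0 hsb; apply: ge_inf; last by exists hs.
by exists 0 => _ [hs' _ <-]; exact: hcost_ge0.
Qed.

(** Profiles in the box are finitely many, coded by tuples of ordinals through [i - A]. A true
    minimizer supplies the height at which to resample a column. *)
Lemma Sbox_attained A w n m : exists2 hs, inbox A n hs & Sbox A w n m = hcost w 0 0 hs m.
Proof.
pose hts (t : n.-tuple 'I_A.*2.+1) : seq int := [seq (nat_of_ord i)%:Z - A%:Z | i : 'I_A.*2.+1 <- t].
have htsb t : inbox A n (hts t).
  rewrite /inbox size_map size_tuple eqxx /=; apply/allP => _ /mapP[i _ ->].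
  have := ltn_ord i; lia.
have boxhts hs : inbox A n hs -> exists t, hts t = hs.
  move=> /andP[hsn /allP hsb].
  have tn : size [seq (inord `|(h + A%:Z)%R|%N : 'I_A.*2.+1) | h <- hs] == n.
    by rewrite size_map.
  exists (Tuple tn); rewrite /hts /= -map_comp -[RHS]map_id; apply/eq_in_map => h hh /=.
  by move: (hsb _ hh) => /= hA; rewrite inordK; lia.
case: (arg_minP (fun t => hcost w 0 0 (hts t) m) (erefl : predT [tuple of nseq n ord0])) => t _ tmin.
exists (hts t) => //; apply/eqP; rewrite eq_le; apply/andP; split.
  apply: ge_inf; last by exists (hts t); first exact: htsb.
  by exists (hcost w 0 0 (hts t) m) => _ [hs' /boxhts[t' <-] <-]; exact: tmin.
apply: lb_le_inf.
  by exists (hcost w 0 0 (hts t) m), (hts t); first exact: htsb.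
by move=> _ [hs' /boxhts[t' <-] <-]; exact: tmin.
Qed.

Lemma hcost_mid w x y hp h hq m : hcost w x y (hp ++ h :: hq) m =
  hcost w x y hp h + w (x + (size hp)%:Z, h) + hcost w (x + (size hp).+1%:Z) h hq m.
Proof.
elim: hp x y => [|h' hp IH] x y /=; first by rewrite addr0.
by rewrite IH !addr1Sz !addrA.
Qed.

Lemma eq_hcost w w' x y hs m :
  (forall j z, (j < size hs)%N -> w (x + j%:Z, z) = w' (x + j%:Z, z)) ->
  hcost w x y hs m = hcost w' x y hs m.
Proof.
elim: hs x y => [|h hs IH] x y //= ww'.
rewrite -[x in w (x, h)]addr0 (ww' 0%N h)// addr0; congr (_ + _); apply: IH => j z jn.
by rewrite addr1Sz; exact: ww'.
Qed.

(** [h] is where an optimal profile for [w] crosses column [k]. Going from there to height [i] and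
    back costs twice the distance. As [h] is chosen before [w'], it does not depend on the new
    column. *)
Lemma Sbox_detour A w n m (k : nat) : wnneg w -> (k < n)%N ->
  exists2 h, `|h| <= A%:Z & forall w' i, wnneg w' ->
    (forall (j : nat) z, j != k -> w (j%:Z, z) = w' (j%:Z, z)) -> `|i| <= A%:Z ->
    Sbox A w' n m <= Sbox A w n m + 2 * idist R i h + w' (k%:Z, i).
Proof.
move=> w0 kn; have [hs /andP[/eqP hsn hsb] ->] := Sbox_attained A w n m.
have khs : (k < size hs)%N by rewrite hsn.
exists (nth 0 hs k); first by apply: (allP hsb); rewrite mem_nth.
move=> w' i w0' ww' iA.
have hsE : hs = take k hs ++ nth 0 hs k :: drop k.+1 hs.
  by rewrite -drop_nth// cat_take_drop.
set h := nth _ _ _ in hsE *; set hp := take k hs in hsE; set hq := drop _ _ in hsE.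
have sp : size hp = k by rewrite size_take khs.
have b' : inbox A n (hp ++ i :: hq).
  rewrite /inbox size_cat /= sp size_drop hsn all_cat /= iA /=.
  apply/and3P; split; first by lia.
    by apply/allP => z /mem_take; exact: (allP hsb).
  by apply/allP => z /mem_drop; exact: (allP hsb).
apply: le_trans (Sbox_le _ w0' b') _.
rewrite [in leRHS]hsE !hcost_mid sp !add0r.
have -> : hcost w 0 0 hp h = hcost w' 0 0 hp h.
  by apply: eq_hcost => j z; rewrite sp add0r => jk; apply: ww'; lia.
have -> : hcost w k.+1%:Z h hq m = hcost w' k.+1%:Z h hq m.
  apply: eq_hcost => j z jk; rewrite -[_ + _]/((k.+1 + j)%N%:Z); apply: ww'; lia.
have := hcost_lip w' 0 0 hp h i; have := hcost_lipl w' k.+1%:Z i h hq m.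
have := w0 (k%:Z, h); lra.
Qed.

End Box.

(** * Product law of a column of weights *)

Section Column.
Variables (R : realType) (V I : finType) (g : V -> R).
Hypothesis g_ge0 : forall a, 0 <= g a.
Hypothesis g_sum1 : \sum_a g a = 1.

Definition colw (c : {ffun I -> V}) : R := \prod_i g (c i).

Lemma colw_ge0 c : 0 <= colw c.
Proof. by apply: prodr_ge0. Qed.

(** Independence within a column: the sum of products factorizes, and coordinates outside [D]
    contribute total mass 1. *)
Lemma colw_event (bad : pred V) (D : {set I}) :
  \sum_c colw c * [forall i in D, bad (c i)]%:R = (\sum_(a | bad a) g a) ^+ #|D|.
Proof.
transitivity (\sum_(c : {ffun I -> V}) \prod_i (g (c i) * ((i \in D) ==> bad (c i))%:R)).
  apply: eq_bigr => c _; rewrite big_split /=; congr (_ * _).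
  have [/forall_inP h|/forall_inPn[i iD hi]] := boolP [forall i in D, bad (c i)].
    by rewrite big1 // => i _; case iD : (i \in D); rewrite //= h.
  by rewrite (bigD1 i) //= iD (negbTE hi) mul0r.
rewrite -(bigA_distr_bigA (fun i a => g a * ((i \in D) ==> bad a)%:R)) /=.
rewrite (bigID (mem D)) /= [X in _ * X]big1 ?mulr1; last first.
  by move=> i /negbTE ->; rewrite -[RHS]g_sum1; apply: eq_bigr => a _; rewrite mulr1.
rewrite -prodr_const; apply: eq_bigr => i ->; rewrite [RHS]big_mkcond.
by apply: eq_bigr => a _; case: (bad a); rewrite ?mulr1 ?mulr0.
Qed.

Lemma colw_sum1 : \sum_c colw c = 1.
Proof.
have := colw_event predT finset.set0; rewrite cards0 expr0 => <-.
apply: eq_bigr => c _; case: forallP => [_|[]]; first by rewrite mulr1.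
by move=> i; rewrite inE.
Qed.

End Column.

(** * Variance bound uniform in the truncation *)

Section Truncated.
Variables (R : realType) (A N : nat).
Hypothesis N0 : (0 < N)%N.
Let K := (A * N)%N.
Let V := 'I_K.+1.
Let I := 'I_A.*2.+1.
Variable g : V -> R.
Hypothesis g_ge0 : forall a, 0 <= g a.
Hypothesis g_sum1 : \sum_a g a = 1.
Variable q : nat.
Definition gridv (v : V) : R := (v : nat)%:R / N%:R.
Hypothesis g_q : \sum_(a | q%:R < gridv a) g a <= 8^-1.

(* Capping heights and weights at [A] and rounding the weights to multiples of
   [1 / N] turns a column into an element of a finite type; for large [A] the cap
   is invisible to optimal paths (see [Smin_Sgrid]). *)
Definition wgrid (s : seq {ffun I -> V}) : pt2 -> R :=
  fun e => gridv (nth [ffun=> ord0] s `|e.1|%N (inord `|(e.2 + A%:Z)%R|%N)).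

Lemma gridv_ge0 v : 0 <= gridv v.
Proof. by rewrite /gridv divr_ge0. Qed.

Lemma gridv_le v : gridv v <= A%:R.
Proof.
rewrite /gridv ler_pdivrMr ?ltr0n// -natrM ler_nat.
by have := ltn_ord v; rewrite ltnS.
Qed.

(** Heights are tried one after another from [h] until a weight is at most [q]. The first [j] trials
    all fail with probability at most [8^-j], which beats the growth [4^j] of the squared detour;
    this dictates the threshold [8^-1] on [q]. *)
Lemma detour_expectation (h : int) : `|h| <= A%:Z ->
  exists2 B : {ffun I -> V} -> R,
   (forall (c : {ffun I -> V}) (x : R), 0 <= x -> (forall i : int, `|i| <= A%:Z ->
      x <= 2 * idist R i h + gridv (c (inord `|(i + A%:Z)%R|%N))) -> x ^+ 2 <= B c) &
   \sum_c colw g c * B c <= 2 * (q%:R + 2) ^+ 2 + 1.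
Proof.
move=> hA.
(* Moving from [h] in the direction of 0 keeps [A + 1] successive heights inside the box. *)
pose run (j : nat) : int := if h <= 0 then h + j%:Z else h - j%:Z.
pose irun (j : nat) : I := inord `|(run j + A%:Z)%R|%N.
have runA j : (j <= A)%N -> `|run j| <= A%:Z by rewrite /run; case: ifP; lia.
have rund (j : nat) : idist R (run j) h = j%:R.
  rewrite /idist; suff -> : `|run j - h| = j%:Z by [].
  by rewrite /run; case: ifP; lia.
pose D (j : nat) : {set I} := [set i in [seq irun k | k <- iota 0 j]].
have cardD j : (j <= A.+1)%N -> #|D j| = j.
  move=> jA; rewrite cardsE -[RHS](size_iota 0 j) -(size_map irun); apply/card_uniqP.
  rewrite map_inj_in_uniq ?iota_uniq// => k k'; rewrite !mem_iota !add0n => kj kj'.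
  have := runA k; have := runA k' => rk rk'.
  move=> /(congr1 (@nat_of_ord _)); rewrite /irun !inordK; try lia.
  by rewrite /run; case: ifP; lia.
pose bad (v : V) := q%:R < gridv v.
pose r (j : nat) (c : {ffun I -> V}) : R := [forall i in D j, bad (c i)]%:R.
have r1 j (c : {ffun I -> V}) : (forall k, (k < j)%N -> bad (c (irun k))) -> r j c = 1.
  move=> h1; rewrite /r; case: forallP => // -[] i; apply/implyP.
  by rewrite inE => /mapP[k]; rewrite mem_iota => kj ->; apply: h1; lia.
have Er j : (j <= A.+1)%N -> \sum_c colw g c * r j c <= 8^-1 ^+ j.
  move=> jA; rewrite /r colw_event// cardD//.
  by rewrite lerXn2r ?nnegrE ?invr_ge0 ?sumr_ge0.
(* If [j] is the first success, the [j]-th summand alone suffices. If all [A + 1] trials fail, no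
   detour is made and the capped weight at [h], at most [A], is paid. *)
exists (fun c => \sum_(j < A.+1) r j c * (2 * j%:R + q%:R) ^+ 2 + r A.+1 c * A%:R ^+ 2).
  move=> c x x0 xle.
  have t0 (j : 'I_A.+1) : 0 <= r j c * (2 * j%:R + q%:R) ^+ 2.
    by apply: mulr_ge0; [rewrite /r|exact: sqr_ge0].
  have [/existsP[j0 j0g]|/existsPn nog] := boolP [exists j : 'I_A.+1, ~~ bad (c (irun j))].
    case: (@arg_minnP _ j0 (fun j : 'I_A.+1 => ~~ bad (c (irun j))) (fun j => j) j0g) => j jg jmin.
    rewrite (bigD1 j)//= r1 ?mul1r; last first.
      move=> k kj; rewrite -[bad _]negbK; apply/negP => kg.
      have kA : (k < A.+1)%N by have := ltn_ord j; lia.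
      by have := jmin (Ordinal kA) kg; rewrite leqNgt kj.
    have xj : x <= 2 * j%:R + q%:R.
      have := xle (run j); rewrite rund => /(_ (runA _ _)) xle'.
      have : gridv (c (irun j)) <= q%:R by rewrite leNgt.
      by have := xle' (ltn_ord j); rewrite /irun; lra.
    have : x ^+ 2 <= (2 * j%:R + q%:R) ^+ 2.
      by rewrite lerXn2r ?nnegrE//; lra.
    have : 0 <= \sum_(i < A.+1 | i != j) r i c * (2 * i%:R + q%:R) ^+ 2.
      by apply: sumr_ge0.
    have : 0 <= r A.+1 c * A%:R ^+ 2.
      by apply: mulr_ge0; [rewrite /r|exact: sqr_ge0].
    lra.
  rewrite [r A.+1 c]r1 ?mul1r; last first.
    by move=> k kA; have := nog (Ordinal kA); rewrite negbK.
  have xA : x <= A%:R.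
    have := xle (run 0); rewrite rund mulr0 add0r => /(_ (runA 0%N isT)) xle'.
    exact: le_trans xle' (gridv_le _).
  have : x ^+ 2 <= A%:R ^+ 2 by rewrite lerXn2r ?nnegrE//.
  have : 0 <= \sum_(i < A.+1) r i c * (2 * i%:R + q%:R) ^+ 2.
    by apply: sumr_ge0.
  lra.
under eq_bigr do rewrite mulrDr.
rewrite big_split /=; apply: lerD; last first.
  under eq_bigr do rewrite mulrA.
  rewrite -mulr_suml; apply: (@le_trans _ _ (8^-1 ^+ A.+1 * A%:R ^+ 2)).
    by apply: ler_wpM2r; [exact: sqr_ge0|exact: Er].
  (* [A ^ 2 <= 8 ^ (A + 1)]: the case of total failure contributes at most 1. *)
  rewrite exprVn mulrC ler_pdivrMr ?exprn_gt0// mul1r -!natrX ler_nat.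
  have : (A < 2 ^ A)%N by exact: ltn_expl.
  rewrite -[8%N]/(2 ^ 3)%N -expnM -mulnn; set z := (2 ^ A)%N.
  have -> : (2 ^ (3 * A.+1) = 8 * (z * z * z))%N.
    by rewrite mulnS expnD !mulSn addn0 !expnD mulnA.
  nia.
under eq_bigr do rewrite mulr_sumr.
rewrite exchange_big /=.
have term (j : 'I_A.+1) : \sum_c colw g c * (r j c * (2 * j%:R + q%:R) ^+ 2) <=
    (q%:R + 2) ^+ 2 * 2^-1 ^+ j.
  under eq_bigr do rewrite mulrA.
  rewrite -mulr_suml.
  (* From [j + 1 <= 2 ^ j]. Against [8^-j] a factor [2^-j] remains, and its sum is at most 2. *)
  have j2 : (2 * j%:R + q%:R) ^+ 2 <= ((q%:R + 2) ^+ 2 * 4 ^+ j : R).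
    have -> : 4 = 2 ^+ 2 :> R by rewrite -natrX.
    rewrite -exprM mulnC exprM -exprMn lerXn2r ?nnegrE ?addr_ge0 ?mulr_ge0//.
    have : (j.+1 <= 2 ^ j)%N by exact: ltn_expl.
    rewrite -(ler_nat R) natrX -natr1; set z := 2 ^+ j; set u := (j : nat)%:R.
    have : 0 <= u by []. have : 0 <= q%:R :> R by []. nra.
  apply: le_trans (ler_wpM2l _ j2) _.
    by apply: sumr_ge0 => c _; apply: mulr_ge0; [exact: colw_ge0|rewrite /r].
  apply: (@le_trans _ _ (8^-1 ^+ j * ((q%:R + 2) ^+ 2 * 4 ^+ j))).
    apply: ler_wpM2r; last by apply: Er; exact: ltnW.
    by rewrite mulr_ge0 ?sqr_ge0// exprn_ge0.
  rewrite mulrCA -exprMn; have -> : 8^-1 * 4 = 2^-1 :> R by field.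
  exact: lexx.
apply: le_trans (ler_sum _ (fun j _ => term j)) _.
rewrite -mulr_sumr [leRHS]mulrC; apply: ler_wpM2l; first exact: sqr_ge0.
have : forall n, \sum_(i < n) 2^-1 ^+ i + 2 * 2^-1 ^+ n = 2 :> R.
  elim=> [|n IH]; first by rewrite big_ord0 add0r expr0 mulr1.
  by rewrite big_ord_recr /= exprS; lra.
move=> /(_ A.+1); have : 0 <= 2^-1 ^+ A.+1 :> R by rewrite exprn_ge0 ?invr_ge0.
by lra.
Qed.

Definition Sgrid n m (s : seq {ffun I -> V}) : R := Sbox A (wgrid s) n m.

(** The bound is free of [A] and [N], so the truncation may be chosen depending on [n] and [m]. *)
Lemma Sbox_variance n m :
  Ex (colw g) n (fun s => (Sgrid n m s - Ex (colw g) n (Sgrid n m)) ^+ 2) <=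
    2 * n%:R * (2 * (q%:R + 2) ^+ 2 + 1).
Proof.
apply: efron_stein.
- exact: colw_ge0.
- exact: colw_sum1.
move=> p a s ps.
have w0 s' : wnneg (wgrid s') by move=> e; exact: gridv_ge0.
have kn : (size p < n)%N by lia.
have [h hA hd] := Sbox_detour A m (w0 (p ++ a :: s)) kn.
have [B HB EB] := detour_expectation hA.
apply: le_trans EB; apply: ler_sum => b _.
apply: ler_wpM2l; first exact: colw_ge0.
apply: HB; first exact: posd_ge0.
move=> i iA; rewrite /posd ge_max; apply/andP; split.
  by apply: addr_ge0; [rewrite mulr_ge0 ?idist_ge0|exact: gridv_ge0].
have := hd (wgrid (p ++ b :: s)) i (w0 _).
have -> : wgrid (p ++ b :: s) ((size p)%:Z, i) = gridv (b (inord `|(i + A%:Z)%R|%N)).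
  by rewrite /wgrid /= nth_cat ltnn subnn.
rewrite lerBlDl addrA; apply => //.
move=> j z jk; rewrite /wgrid /= !nth_cat; case: ltnP => // pj.
case E : (j - size p)%N => [|u] //.
by move/eqP: E; rewrite subn_eq0 => jp; rewrite eqn_leq jp pj in jk.
Qed.

End Truncated.

(** * Finite-dimensional laws of the environment *)

Section FiniteLaw.
Context d (Omega : measurableType d) (R : realType) (P : probability Omega R).

Lemma probability_partition (T : finType) (X : Omega -> T) (E : set Omega) :
  (forall a, measurable (E `&` X @^-1` [set a])) ->
  measurable E /\ P E = (\sum_a P (E `&` X @^-1` [set a]))%E.
Proof.
move=> mE.
have EE : E = \bigcup_(a in [set: T]) (E `&` X @^-1` [set a]).
  apply/seteqP; split => [om Eom|om [a _ [Eom _]]] //.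
  by exists (X om).
split; first by rewrite EE; apply: fin_bigcup_measurable => //; exact: finite_finset.
rewrite [in LHS]EE measure_fin_bigcup//.
- have -> : [set: T] = [set` enum T].
    by apply/seteqP; split => a //= _; rewrite mem_enum.
  by rewrite -fsbig_seq ?enum_uniq// big_enum.
- exact: finite_finset.
- by move=> a b _ _ [om [[_ <-] [_ <-]]].
Qed.

Variables (V : finType) (rho : V -> R) (X : nat -> Omega -> V).
Hypothesis mX : forall k s, size s = k ->
  measurable [set om | [seq X x om | x <- iota 0 k] = s].
Hypothesis lawX : forall k s, size s = k ->
  P [set om | [seq X x om | x <- iota 0 k] = s] = (\prod_(c <- s) rho c)%:E.

(** Fixing a prefix [s] makes the induction possible: each step reveals one more letter at the end
    of [s], while [Ex] averages over the [n] letters still unknown. *)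
Lemma law_event_prefix n k (s : seq V) (B : pred (seq V)) : size s = k ->
  let E := [set om | [seq X x om | x <- iota 0 k] = s /\
                     B [seq X x om | x <- iota 0 (k + n)]] in
  measurable E /\
  P E = (\prod_(c <- s) rho c * Ex rho n (fun t => (B (s ++ t))%:R))%:E.
Proof.
elim: n k s B => [|n IH] k s B sk E.
  rewrite /= cats0; case Bs : (B s).
    have -> : E = [set om | [seq X x om | x <- iota 0 k] = s].
      by apply/seteqP; split => om /=; [case|move=> h; rewrite /E /= addn0 h].
    by rewrite mulr1 lawX//; split => //; exact: mX.
  have -> : E = set0.
    by rewrite -subset0 => om [h]; rewrite addn0 h Bs.
  by rewrite measure0 mulr0; split.
have EX a : E `&` X k @^-1` [set a] =
    [set om | [seq X x om | x <- iota 0 k.+1] = rcons s a /\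
              B [seq X x om | x <- iota 0 (k.+1 + n)]].
  have iotak om : [seq X x om | x <- iota 0 k.+1] = rcons [seq X x om | x <- iota 0 k] (X k om).
    by rewrite -addn1 iotaD map_cat /= cats1 add0n.
  apply/seteqP; split => om.
    by move=> [[h Bh] Xa]; split; [rewrite iotak h Xa|rewrite addSnnS].
  by move=> []; rewrite iotak addSnnS => /rcons_inj[h Xa] ?.
have IHa a := IH k.+1 (rcons s a) B (etrans (size_rcons _ _) (congr1 succn sk)).
have [mE ->] : measurable E /\ P E = (\sum_a P (E `&` X k @^-1` [set a]))%E.
  by apply: probability_partition => a; rewrite EX; case: (IHa a).
split => //=; rewrite mulr_sumr -sumEFin; apply: eq_bigr => a _.
rewrite EX; have [_ ->] := IHa a; congr (_%:E).
rewrite -cats1 big_cat big_seq1 /= -mulrA; congr (_ * (_ * _)).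
by apply: eq_Ex => t _; rewrite -catA.
Qed.

Lemma law_event n (B : pred (seq V)) :
  measurable [set om | B [seq X x om | x <- iota 0 n]] /\
  P [set om | B [seq X x om | x <- iota 0 n]] = (Ex rho n (fun t => (B t)%:R))%:E.
Proof.
have [] := @law_event_prefix n 0 [::] B erefl.
have -> : [set om | [seq X x om | x <- iota 0 0] = [::] /\
    B [seq X x om | x <- iota 0 (0 + n)]] = [set om | B [seq X x om | x <- iota 0 n]].
  by apply/seteqP; split => om /=; [case|move=> ?; split].
by rewrite big_nil mul1r.
Qed.

End FiniteLaw.

(** * Independent weights of law [G] and their discretization *)

Section IID.
Context (R : realType) (G : probability R R) (d : measure_display)
  (Omega : measurableType d) (P : probability Omega R).
Implicit Types w : pt2 -> {RV P >-> R}.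

Definition iidG w :=
  (forall e (A : set R), measurable A -> distribution P (w e) A = G A) /\
  mutually_indep w.

(** Relabelling edges injectively preserves independence. Shifts, reflection and shears are all of
    this form. *)
Lemma iidG_reindex w (phi psi : pt2 -> pt2) : cancel phi psi -> iidG w ->
  iidG (fun e => w (phi e)).
Proof.
move=> phiK [law ind]; split=> [e A mA|J A uJ mA]; first exact: law.
have := ind (map phi J) (A \o psi); rewrite map_inj_uniq ?uJ; last exact: can_inj phiK.
move=> /(_ erefl (fun i => mA _)); rewrite big_map /=.
have -> : \bigcap_(i in [set i | i \in map phi J]) (w i @^-1` A (psi i)) =
    \bigcap_(i in [set i | i \in J]) (w (phi i) @^-1` A i).
  apply/seteqP; split => om h i /= iJ.
    by have /= := h (phi i) (map_f _ iJ); rewrite phiK.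
  by move/mapP: iJ => [j jJ ->]; rewrite phiK; exact: h.
by move=> ->; apply: eq_bigr => i _; rewrite phiK.
Qed.

Lemma measurable_gt (c : R) : measurable ([set r | c < r] : set R).
Proof.
have -> : [set r | c < r] = `]c, +oo[%classic :> set R.
  by apply/seteqP; split => x; rewrite /= in_itv /= andbT.
exact: measurable_itv.
Qed.

(** Continuity from above of [G]; this takes the place of any moment assumption. *)
Lemma law_tail (e : R) : 0 < e -> exists q : nat, (G [set r | (q%:R < r)%R] <= e%:E)%E.
Proof.
move=> e0; pose F (n : nat) : set R := [set r | n%:R < r].
have mF n : measurable (F n) by exact: measurable_gt.
have F0 : \bigcap_n F n = set0.
  rewrite -subset0 => r h; have := h (Num.truncn r).+1 I; rewrite /F /=.
  have := truncnS_gt r; lra.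
have : G \o F @ \oo --> G (\bigcap_n F n).
  apply: nonincreasing_cvg_mu => //.
  - by apply: le_lt_trans (probability_le1 _ _) _; rewrite ?ltry.
  - by rewrite F0.
  - move=> n m nm; apply/subsetPset => r; rewrite /F /=.
    by apply: le_lt_trans; rewrite ler_nat.
rewrite F0 measure0 => /fine_cvgP[_].
move=> /cvgrPdist_le /(_ e e0) [N _ /(_ N (leqnn N)) /=].
rewrite sub0r normrN => h; exists N; rewrite -/(F N) -[leLHS]fineK ?lee_fin; last first.
  exact: fin_num_measure.
exact: le_trans (ler_norm _) h.
Qed.

Section Grid.
Variables (A N : nat).
Hypothesis N0 : (0 < N)%N.
Let K := (A * N)%N.
Let V := 'I_K.+1.
Let I := 'I_A.*2.+1.

Definition gidx (r : R) : V := inord (minn (Num.truncn (r * N%:R)) K).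

Lemma gidx_gt (j : nat) r : (j < gidx r)%N = (j < K)%N && (j.+1%:R <= r * N%:R).
Proof.
rewrite /gidx inordK; last by rewrite ltnS geq_minr.
by rewrite leq_min truncn_gt_nat andbC.
Qed.

Lemma measurable_gidx v : measurable [set r | gidx r = v].
Proof.
have mgt (j : nat) : measurable [set r | (j < gidx r)%N].
  have [jK|jK] := ltnP j K; last first.
    by rewrite (_ : [set _ | _] = set0)// -subset0 => r /=; rewrite gidx_gt ltnNge jK.
  rewrite (_ : [set _ | _] = `[j.+1%:R / N%:R, +oo[%classic)//.
  apply/seteqP; split => r /=; rewrite in_itv /= andbT gidx_gt jK /= ler_pdivrMr ?ltr0n//.
have -> : [set r | gidx r = v] =
   (if v == 0 :> nat then setT else [set r | (v.-1 < gidx r)%N]) `\` [set r | (v < gidx r)%N].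
  apply/seteqP; split => r /=.
    by move=> h; split; [case: eqP => //= v0; rewrite h; lia|rewrite h ltnn].
  move=> [h1 h2]; apply/val_inj/eqP; rewrite eqn_leq; apply/andP; split=> /=.
    by rewrite leqNgt; exact/negP.
  by move: h1; case: eqP => /= [->|]//; lia.
by apply: measurableD => //; case: eqP.
Qed.

Definition glaw (v : V) : R := fine (G [set r | gidx r = v]).

Lemma glawE v : G [set r | gidx r = v] = (glaw v)%:E.
Proof. by rewrite /glaw fineK// fin_num_measure//; exact: measurable_gidx. Qed.

Lemma glaw_ge0 v : 0 <= glaw v.
Proof. by rewrite /glaw fine_ge0. Qed.

Lemma glaw_event (b : pred V) : measurable [set r | b (gidx r)] /\
  (\sum_(v | b v) glaw v)%:E = G [set r | b (gidx r)].
Proof.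
have E v : [set r | b (gidx r)] `&` gidx @^-1` [set v] =
    if b v then [set r | gidx r = v] else set0.
  case: ifP => bv; first by apply/seteqP; split => r /= => [[]|->].
  by rewrite -subset0 => r /= [+ rv]; rewrite rv bv.
have [m ->] := @probability_partition _ R R G _ gidx [set r | b (gidx r)] (fun v =>
  eq_ind_r measurable (match b v as c return measurable (if c then [set r | gidx r = v] else set0)
    with true => measurable_gidx v | false => measurable0 end) (E v)).
split => //; rewrite -sumEFin [LHS]big_mkcond /=; apply: eq_bigr => v _.
by rewrite E; case: ifP => _; rewrite ?measure0// glawE.
Qed.

Lemma glaw_sum1 : \sum_v glaw v = 1.
Proof.
apply: EFin_inj; have [_ ->] := glaw_event predT.
by rewrite -[RHS](@probability_setT _ _ _ G); congr (G _); apply/seteqP; split.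
Qed.

Lemma gridv_gidx_le r : 0 <= r -> gridv R (gidx r) <= r.
Proof.
move=> r0; rewrite /gridv ler_pdivrMr ?ltr0n//.
case E : (nat_of_ord (gidx r)) => [|j]; first by rewrite mulr_ge0.
by have := gidx_gt j r; rewrite E ltnSn => /esym /andP[].
Qed.

Lemma gridv_gidx_ge r : gridv R (gidx r) < A%:R -> r <= gridv R (gidx r) + N%:R^-1.
Proof.
rewrite {1}/gridv ltr_pdivrMr ?ltr0n// -natrM ltr_nat -/K => jK.
have := gidx_gt (gidx r) r; rewrite ltnn jK /= => /esym /negbT.
rewrite -ltNge -ltr_pdivlMr ?ltr0n// -natr1 mulrDl mul1r => /ltW.
by rewrite /gridv.
Qed.

Lemma glaw_tail (q : nat) (e : R) : (G [set r | (q%:R < r)%R] <= e%:E)%E ->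
  \sum_(v | q%:R < gridv R v) glaw v <= e.
Proof.
move=> h; rewrite -lee_fin; have [m ->] := glaw_event (fun v => q%:R < gridv R v).
apply: le_trans h; apply: le_measure; rewrite ?inE//.
  exact: measurable_gt.
move=> r /= qr; have [r0|r0] := leP 0 r; first exact: lt_le_trans qr (gridv_gidx_le r0).
exfalso; move: qr; rewrite /gridv /gidx (_ : Num.truncn _ = 0%N).
  by rewrite min0n inordK// mul0r ltrn0.
apply/truncn0Pn; rewrite -ltNge (@le_lt_trans _ _ 0)//.
by rewrite mulr_le0_ge0// ltW.
Qed.

Definition Wcol w (x : nat) (om : Omega) : {ffun I -> V} :=
  [ffun i : I => gidx (w (x%:Z, (nat_of_ord i)%:Z - A%:Z) om)].

(** The event prescribes the rounded weights of the finitely many distinct edges in [J]. Mutual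
    independence gives a product over [J], which regroups into one factor [colw] per column. *)
Lemma Wcol_law w : iidG w -> forall k s, size s = k ->
  measurable [set om | [seq Wcol w x om | x <- iota 0 k] = s] /\
  P [set om | [seq Wcol w x om | x <- iota 0 k] = s] =
    (\prod_(c <- s) colw glaw c)%:E.
Proof.
move=> [law ind] k s sk.
pose J : seq pt2 := [seq (x%:Z, (nat_of_ord i)%:Z - A%:Z) | x <- iota 0 k, i <- enum I].
pose c0 : {ffun I -> V} := [ffun=> ord0].
pose val (e : pt2) : V := nth c0 s `|e.1|%N (inord `|(e.2 + A%:Z)%R|%N).
pose B (e : pt2) : set R := [set r | gidx r = val e].
have valE (x : nat) (i : I) : val (x%:Z, (nat_of_ord i)%:Z - A%:Z) = nth c0 s x i.
  by rewrite /val /= subrK /= inord_val.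
have EE : [set om | [seq Wcol w x om | x <- iota 0 k] = s] =
    \bigcap_(i in [set i | i \in J]) (w i @^-1` B i).
  apply/seteqP; split => om /=.
    move=> h e /allpairsP[[x i] /= [+ _ ->]]; rewrite mem_iota add0n => /= xk.
    rewrite /B /= valE -h (nth_map 0%N) ?size_iota// nth_iota// add0n.
    by rewrite ffunE.
  move=> h; apply: (@eq_from_nth _ c0); rewrite size_map size_iota// => x xk.
  rewrite (nth_map 0%N) ?size_iota// nth_iota// add0n; apply/ffunP => i.
  rewrite ffunE -valE; apply: h; apply/allpairsP; exists (x, i) => /=.
  by rewrite mem_iota add0n xk mem_enum.
have mB e : measurable (B e) by exact: measurable_gidx.
have uJ : uniq J.
  apply: allpairs_uniq; rewrite ?iota_uniq ?enum_uniq// => -[x i] [x' i'] _ _ /= [-> ii].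
  by congr (_, _); apply: val_inj => /=; lia.
split.
  rewrite EE; apply: fin_bigcap_measurable; first exact: finite_seq.
  by move=> e _; rewrite -[X in measurable X]setTI; exact: measurable_funP.
rewrite EE ind//.
rewrite (eq_bigr (fun e => (glaw (val e))%:E)); last first.
  by move=> e _; rewrite -glawE; exact: (law e _ (mB e)).
rewrite prodEFin; congr (_%:E); rewrite big_allpairs_dep /=.
rewrite -[in RHS](mkseq_nth c0 s) /mkseq big_map sk; apply: eq_bigr => x _.
by rewrite /colw -big_enum /=; apply: eq_bigr => i _; rewrite valE.
Qed.

End Grid.
End IID.

(** * Concentration *)

Section HcostBounds.
Variable R : realType.
Implicit Types (w : pt2 -> R) (hs : seq int) (x y m : int).

Lemma le_hcost w w' (c : R) x y hs m :
  (forall j, (j < size hs)%N ->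
     w (x + j%:Z, nth 0 hs j) <= w' (x + j%:Z, nth 0 hs j) + c) ->
  hcost w x y hs m <= hcost w' x y hs m + (size hs)%:R * c.
Proof.
elim: hs x y => [|h hs IH] x y /= ww'; first by rewrite mul0r addr0.
have := ww' 0%N isT; rewrite /= addr0 => w1.
have := IH (x + 1) h (fun j js => eq_ind_r (fun z => w (z, _) <= w' (z, _) + c) (ww' j.+1 js) (addr1Sz x j)).
by rewrite -natr1 mulrDl mul1r; lra.
Qed.

Lemma hcost_nth_height w x y hs m j : wnneg w -> (j < size hs)%N ->
  idist R (nth 0 hs j) y <= hcost w x y hs m.
Proof.
move=> w0; elim: hs x y j => [|h hs IH] x y [|j] //= js.
  have := w0 (x, h); have := hcost_ge0 (x + 1) h hs m w0; lra.
have := w0 (x, h); have := IH (x + 1) h j js.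
have := idist_trans R h (nth 0 hs j) y; lra.
Qed.

Lemma hcost_nth_weight w x y hs m j : wnneg w -> (j < size hs)%N ->
  w (x + j%:Z, nth 0 hs j) <= hcost w x y hs m.
Proof.
move=> w0; elim: hs x y j => [|h hs IH] x y [|j] //= js.
  rewrite addr0; have := idist_ge0 R h y; have := hcost_ge0 (x + 1) h hs m w0; lra.
have := w0 (x, h); have := IH (x + 1) h j js; rewrite addr1Sz.
have := idist_ge0 R h y; lra.
Qed.

Lemma hcost_nseq0 w x n m (c : R) :
  (forall j, (j < n)%N -> w (x + j%:Z, 0) <= c) ->
  hcost w x 0 (nseq n 0) m <= n%:R * c + idist R m 0.
Proof.
elim: n x => [|n IH] x wc /=; first by rewrite mul0r add0r.
have := wc 0%N isT; rewrite addr0 idistxx => w1.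
have := IH (x + 1) (fun j jn => eq_ind_r (fun z => w (z, _) <= c) (wc j.+1 jn) (addr1Sz x j)).
by rewrite -natr1 mulrDl mul1r; lra.
Qed.

End HcostBounds.

Section Concentration.
Context (R : realType) (G : probability R R) (d : measure_display)
  (Omega : measurableType d) (P : probability Omega R).
Implicit Types w : pt2 -> {RV P >-> R}.

Definition senv w (om : Omega) : pt2 -> R := fun e => w e om.

(** The flat profile at height 0 costs at most [n * t0 + |m| = A - 1]. Hence an optimal profile
    neither leaves the box nor meets a capped weight, and rounding to multiples of [1 / (n + 1)]
    over [n] edges changes the cost by less than 1. *)
Lemma Smin_Sgrid w om (n t0 A : nat) m s : wnneg (senv w om) ->
  (forall x, (x < n)%N -> w (x%:Z, 0) om <= t0%:R) ->
  A = (n * t0 + `|m|%N).+1 ->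
  s = [seq Wcol A n.+1 w x om | x <- iota 0 n] ->
  Sgrid R n m s <= Smin (senv w om) n m <= Sgrid R n m s + 1.
Proof.
move=> u0 ut AE sE; set u := senv w om in u0 *.
have N0 : (0 < n.+1)%N by [].
have g0 : wnneg (wgrid R s) by move=> e; exact: gridv_ge0.
have wgE (x : nat) y : (x < n)%N -> `|y| <= A%:Z ->
    wgrid R s (x%:Z, y) = gridv R (gidx A n.+1 (u (x%:Z, y))).
  move=> xn yA; rewrite /wgrid sE [fst _]/= [snd _]/= (nth_map 0%N) ?size_iota//.
  rewrite nth_iota// add0n ffunE inordK; last by lia.
  by congr (gridv R (gidx A n.+1 (w (_, _) om))); lia.
have wgle hs : inbox A n hs -> hcost (wgrid R s) 0 0 hs m <= hcost u 0 0 hs m.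
  move=> /andP[/eqP hsn /allP hsA].
  have := @le_hcost _ (wgrid R s) u 0 0 0 hs m; rewrite mulr0 addr0; apply => j js.
  rewrite add0r addr0 wgE ?gridv_gidx_le//; first by rewrite -hsn.
  exact/hsA/mem_nth.
have box0 : inbox A n (nseq n 0).
  by rewrite /inbox size_nseq eqxx /=; apply/allP => h; rewrite mem_nseq => /andP[_ /eqP ->].
have u00 : hcost u 0 0 (nseq n 0) m + 1 <= A%:R.
  have := @hcost_nseq0 _ u 0 n m t0%:R (fun j jn => eq_ind_r (fun z => u (z, _) <= _) (ut j jn) (add0r _)).
  rewrite AE -natr1 natrD natrM /idist subr0 => h.
  apply: le_trans (lerD h (lexx _)) _; rewrite lerD2r lerD2l.
  by rewrite -[`|m|]abszE.
have Sg0 : Sgrid R n m s + 1 <= A%:R.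
  apply: le_trans u00; rewrite lerD2r.
  exact: le_trans (Sbox_le m g0 box0) (wgle _ box0).
apply/andP; split.
  apply: Smin_ge => hs hsn.
  have [b|] := boolP (inbox A n hs).
    exact: le_trans (Sbox_le m g0 b) (wgle _ b).
  (* Reaching a height beyond [A] already costs more than [A]. *)
  rewrite /inbox hsn eqxx /= => /allPn[h hh]; rewrite -ltNge => hA.
  have := @hcost_nth_height _ u 0 0 hs m (index h hs) u0.
  rewrite index_mem hh nth_index// => /(_ isT).
  have : A%:R < idist R h 0.
    by rewrite /idist subr0 -[A%:R]/(A%:Z%:~R) ltr_int.
  lra.
have [hs hsb SE] := Sbox_attained A (wgrid R s) n m.
rewrite [X in _ <= X + _]SE.
have /andP[/eqP hsn /allP hsA] := hsb.
apply: le_trans (Smin_le u0 m hsn) _.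
apply: (@le_trans _ _ (hcost (wgrid R s) 0 0 hs m + (size hs)%:R * (n.+1%:R)^-1)).
  apply: le_hcost => j js; rewrite add0r.
  have jn : (j < n)%N by rewrite -hsn.
  have hj := hsA _ (mem_nth 0 js).
  rewrite wgE//; apply: gridv_gidx_ge => //.
  have := @hcost_nth_weight _ (wgrid R s) 0 0 hs m j g0 js.
  rewrite add0r wgE// -SE; move: Sg0; rewrite /Sgrid; lra.
by rewrite lerD2l ler_pdivrMr ?ltr0n// mul1r hsn ler_nat.
Qed.

(** [a] is fixed before [w], so one centring serves every environment. [E] joins the Chebyshev event
    for the truncated time and the event of a large weight on the axis; the extra 1 in [t + 1] is
    the truncation error. *)
Lemma concentration : exists2 C : R, 0 <= C & forall (n : nat) (m : int),
  exists a : R, forall w, iidG G w -> forall t : R, 0 < t ->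
  exists E : set Omega, [/\ measurable E,
    (P E <= (C * n%:R / t ^+ 2 + (8 * n.+1%:R)^-1)%:E)%E &
    forall om, ~ E om -> wnneg (senv w om) ->
      `|Smin (senv w om) n m - a| <= t + 1].
Proof.
have [q qt] := @law_tail R G 8^-1 ltac:(by rewrite invr_gt0).
exists (2 * (2 * (q%:R + 2) ^+ 2 + 1)).
  by rewrite mulr_ge0// addr_ge0// mulr_ge0// sqr_ge0.
move=> n m.
(* A union over the [n] axis edges turns this tail into at most [1 / (8 * (n + 1))]. *)
have [t0 tt0] := @law_tail R G ((8 * n.+1%:R * n.+1%:R)^-1) ltac:(by rewrite invr_gt0 !mulr_gt0// ltr0n).
pose A := (n * t0 + `|m|%N).+1.
pose g := @glaw R G A n.+1.
pose a := Ex (colw g) n (Sgrid R n m).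
exists a => w iw t t_gt0.
have N0 : (0 < n.+1)%N by [].
have lawW := @Wcol_law R G d Omega P A n.+1 N0 w iw.
pose B (s : seq {ffun 'I_A.*2.+1 -> 'I_(A * n.+1).+1}) := t < `|Sgrid R n m s - a|.
have [mE1 PE1] := @law_event _ _ _ P _ (colw g) (Wcol A n.+1 w)
  (fun k s sk => proj1 (lawW k s sk)) (fun k s sk => proj2 (lawW k s sk)) n B.
set E1 := (X in measurable X) in mE1.
rewrite -/E1 in PE1.
pose F (x : nat) : set Omega := w (x%:Z, 0) @^-1` [set r | t0%:R < r].
have mF x : measurable (F x).
  rewrite -[F x]setTI; apply: measurable_funP => //; exact: measurable_gt.
pose E2 := \big[setU/set0]_(x < n) F x.
have mE2 : measurable E2 by apply: bigsetU_measurable.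
have PE2 : (P E2 <= ((8 * n.+1%:R)^-1)%:E)%E.
  apply: le_trans (Boole_inequality _ _) _ => //.
  apply: (@le_trans _ _ (\sum_(x < n) ((8 * n.+1%:R * n.+1%:R)^-1)%:E)%E).
    apply: lee_sum => x _; apply: le_trans tt0.
    by have [law _] := iw; rewrite -(law (x%:Z, 0)) ?lexx//; exact: measurable_gt.
  rewrite sumEFin sumr_const card_ord lee_fin -[leLHS]mulr_natl invfM mulrCA.
  apply: ler_piMr; first by rewrite invr_ge0 mulr_ge0.
  by rewrite ler_pdivrMr ?ltr0n// mul1r ler_nat.
exists (E1 `|` E2); split; first exact: measurableU.
  apply: le_trans (measureU2 _ _ _) _ => //.
  rewrite EFinD; apply: leeD => //.
  apply: (@le_trans _ _ (Ex (colw g) n (fun s => (B s)%:R))%:E).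
    by rewrite le_eqVlt; apply/orP; left; apply/eqP; exact: PE1.
  rewrite lee_fin.
  apply: le_trans (Ex_chebyshev _ _ _ _ t_gt0) _.
    exact: colw_ge0 (@glaw_ge0 _ _ _ _).
  rewrite ler_pM2r ?invr_gt0 ?exprn_gt0//.
  apply: le_trans (Sbox_variance N0 _ _ _ _ _) _.
  - exact: glaw_ge0.
  - exact: glaw_sum1.
  - by apply: glaw_tail qt.
  by rewrite -mulrA [n%:R * _]mulrC mulrA.
move=> om nE u0.
have ut x : (x < n)%N -> w (x%:Z, 0) om <= t0%:R.
  move=> xn; rewrite leNgt; apply/negP => h; apply: nE; right.
  by rewrite /E2 -bigcup_mkord; exists x.
have := Smin_Sgrid u0 ut (erefl A) erefl.
set s := map _ _; have : `|Sgrid R n m s - a| <= t.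
  by rewrite leNgt; apply/negP => h; apply: nE; left.
rewrite !ler_norml; set x := Sgrid _ _ _ _; set y := Smin _ _ _; lra.
Qed.

End Concentration.

(** * Deterministic consequences of concentration *)

Section Typical.
Context (R : realType) (G : probability R R) (d : measure_display)
  (Omega : measurableType d) (P : probability Omega R).
Implicit Types w : pt2 -> {RV P >-> R}.
Hypothesis HGsupp : G [set x : R | 0 <= x] = 1%E.

Lemma iidG_nonneg w : iidG G w -> {ae P, forall om, wnneg (senv w om)}.
Proof.
move=> [law _].
have h (e : pt2) : {ae P, forall om, 0 <= w e om}.
  have m0 : measurable ([set x : R | 0 <= x] : set R).
    have -> : [set x : R | 0 <= x] = `[0, +oo[%classic.
      by apply/seteqP; split => x; rewrite /= in_itv /= andbT.
    exact: measurable_itv.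
  exists (~` (w e @^-1` [set x : R | 0 <= x])); split => //.
    by apply: measurableC; rewrite -[X in measurable X]setTI; exact: measurable_funP.
  rewrite probability_setC; last first.
    by rewrite -[X in measurable X]setTI; exact: measurable_funP.
  have := law e _ m0; rewrite HGsupp => h1.
  apply/eqP; rewrite sube_eq ?add0e //; apply/eqP; exact: esym h1.
have : {ae P, forall om, forall k : nat, if unpickle k is Some e then 0 <= w e om else true}.
  by apply/ae_foralln => k; case: (unpickle k) => [e|]; [exact: h|exact: aeW].
apply: filterS => om hk e; have := hk (pickle e); by rewrite pickleK.
Qed.

(** Three events of probability at most [1 / 4] and a null set cannot cover the space. At the
    outcome found, a pathwise inequality between three passage times becomes an inequality for
    [a]. *)
Lemma exists_typical (E1 E2 E3 : set Omega) (Q : Omega -> Prop) :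
  measurable E1 -> measurable E2 -> measurable E3 ->
  (P E1 <= (4^-1)%:E)%E -> (P E2 <= (4^-1)%:E)%E -> (P E3 <= (4^-1)%:E)%E ->
  {ae P, forall om, Q om} -> exists om, [/\ ~ E1 om, ~ E2 om, ~ E3 om & Q om].
Proof.
move=> m1 m2 m3 p1 p2 p3 [N [mN PN QN]].
apply: contrapT => /forallNP h.
have : (P setT <= P (((E1 `|` E2) `|` E3) `|` N))%E.
  apply: le_measure; rewrite ?inE//; first by do 3 apply: measurableU => //.
  move=> om _; have [Qom|nQ] := pselect (Q om); last by right; exact: QN.
  left; apply: contrapT => nE; apply: (h om); split => //.
  - by move=> ?; apply: nE; left; left.
  - by move=> ?; apply: nE; left; right.
  - by move=> ?; apply: nE; right.
rewrite probability_setT; apply/negP; rewrite -ltNge.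
apply: (@le_lt_trans _ _ (((4^-1)%:E + (4^-1)%:E + (4^-1)%:E) + 0)%E).
  apply: le_trans (measureU2 _ _ _) _ => //; first by do 2 apply: measurableU => //.
  apply: leeD; last by rewrite -PN lexx.
  apply: le_trans (measureU2 _ _ _) _ => //; first exact: measurableU.
  apply: leeD => //.
  apply: le_trans (measureU2 _ _ _) _ => //.
  exact: leeD.
by rewrite adde0 -!EFinD lte_fin; lra.
Qed.

Variable C : R.
Hypothesis C_ge0 : 0 <= C.
Variable a : nat -> int -> R.
Hypothesis a_conc : forall n m w, iidG G w -> forall t : R, 0 < t ->
  exists E : set Omega, [/\ measurable E,
    (P E <= (C * n%:R / t ^+ 2 + (8 * n.+1%:R)^-1)%:E)%E &
    forall om, ~ E om -> wnneg (senv w om) ->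
      `|Smin (senv w om) n m - a n m| <= t + 1].

(** The scale [t = (8 * C + 1) * sqrt (n + 1)] makes the Chebyshev term at most [1 / 8]; the final 1
    is the truncation error. *)
Definition fluct (n : nat) : R := (8 * C + 1) * Num.sqrt n.+1%:R + 1.

Lemma a_typical n m w : iidG G w -> exists E : set Omega, [/\ measurable E,
    (P E <= (4^-1)%:E)%E &
    forall om, ~ E om -> wnneg (senv w om) ->
      `|Smin (senv w om) n m - a n m| <= fluct n].
Proof.
move=> iw; pose t := (8 * C + 1) * Num.sqrt (n.+1%:R : R).
have t0 : 0 < t.
  by apply: mulr_gt0; [have := C_ge0; lra|rewrite sqrtr_gt0 ltr0n].
have [E [mE PE hE]] := a_conc n m iw t0; exists E; split => //.
apply: le_trans PE _; rewrite lee_fin.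
have n1 : 0 < n.+1%:R :> R by rewrite ltr0n.
have : C * n%:R / t ^+ 2 <= 8^-1.
  rewrite ler_pdivrMr ?exprn_gt0// /t exprMn sqr_sqrtr ?(ltW n1)//.
  apply: (@le_trans _ _ (C * n.+1%:R)); first by rewrite ler_wpM2l// ler_nat.
  by rewrite mulrA ler_wpM2r ?(ltW n1)//; have := C_ge0; nra.
have : (8 * n.+1%:R)^-1 <= 8^-1 :> R.
  by rewrite lef_pV2 ?posrE ?mulr_gt0// ler_peMr// ler1n.
by move=> h1 h2; apply: le_trans (lerD h2 h1) _; lra.
Qed.

Variable w : pt2 -> {RV P >-> R}.
Hypothesis iw : iidG G w.

Let shiftw (i j : int) : pt2 -> {RV P >-> R} := fun e => w (e.1 + i, e.2 + j).
Let oppw : pt2 -> {RV P >-> R} := fun e => w (e.1, - e.2).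

Let i_shiftw i j : iidG G (shiftw i j).
Proof.
apply: (@iidG_reindex _ _ _ _ _ w (fun e => (e.1 + i, e.2 + j)) (fun e => (e.1 - i, e.2 - j))) => //.
by move=> [x y] /=; rewrite !addrK.
Qed.

Let i_oppw : iidG G oppw.
Proof.
apply: (@iidG_reindex _ _ _ _ _ w (fun e => (e.1, - e.2)) (fun e => (e.1, - e.2))) => //.
by move=> [x y] /=; rewrite opprK.
Qed.

Lemma a_triangle n1 n2 m1 m2 : a (n1 + n2) (m1 + m2) <=
  a n1 m1 + a n2 m2 + fluct n1 + fluct n2 + fluct (n1 + n2).
Proof.
have [E1 [M1 P1 H1]] := a_typical n1 m1 iw.
have [E2 [M2 P2 H2]] := a_typical n2 m2 (i_shiftw n1%:Z m1).
have [E3 [M3 P3 H3]] := a_typical (n1 + n2) (m1 + m2) iw.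
have [om [e1 e2 e3 u0]] := exists_typical M1 M2 M3 P1 P2 P3 (iidG_nonneg iw).
have u0' : wnneg (senv (shiftw n1%:Z m1) om) by move=> e; exact: u0.
have := H1 _ e1 u0; have := H2 _ e2 u0'; have := H3 _ e3 u0.
have := Smin_triangle n1 n2 m1 m2 u0; rewrite -[wshift _ _ _]/(senv (shiftw n1%:Z m1) om).
rewrite !ler_norml; lra.
Qed.

Lemma a_compare n m n' m' (c : R) :
  (forall u : pt2 -> R, wnneg u -> Smin u n m <= Smin u n' m' + c) ->
  a n m <= a n' m' + c + fluct n + fluct n'.
Proof.
move=> h.
have [E1 [M1 P1 H1]] := a_typical n m iw.
have [E2 [M2 P2 H2]] := a_typical n' m' iw.
have [om [e1 e2 _ u0]] := exists_typical M1 M2 M1 P1 P2 P1 (iidG_nonneg iw).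
have := H1 _ e1 u0; have := H2 _ e2 u0; have := h _ u0.
rewrite !ler_norml; lra.
Qed.

Lemma a_lip n m m' : a n m' <= a n m + idist R m' m + fluct n + fluct n.
Proof. by apply: a_compare => u u0; exact: Smin_lip. Qed.

Lemma a_mono n k m : a n m <= a (n + k) m + fluct n + fluct (n + k).
Proof.
have := @a_compare n m (n + k) m 0; rewrite addr0; apply => u u0.
by rewrite addr0; exact: Smin_mono.
Qed.

Lemma a_opp n m : a n m <= a n (- m) + fluct n + fluct n.
Proof.
have [E1 [M1 P1 H1]] := a_typical n m i_oppw.
have [E2 [M2 P2 H2]] := a_typical n (- m) iw.
have [om [e1 e2 _ u0]] := exists_typical M1 M2 M1 P1 P2 P1 (iidG_nonneg iw).
have u0' : wnneg (senv oppw om) by move=> e; exact: u0.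
have := H1 _ e1 u0'; have := H2 _ e2 u0; have := Smin_opp n m u0.
rewrite -[wopp _]/(senv oppw om) !ler_norml; lra.
Qed.

Lemma a_lower n m : - fluct n <= a n m.
Proof.
have [E1 [M1 P1 H1]] := a_typical n m iw.
have [om [e1 _ _ u0]] := exists_typical M1 M1 M1 P1 P1 P1 (iidG_nonneg iw).
have := H1 _ e1 u0; have := Smin_ge0 u0 n m; rewrite ler_norml; lra.
Qed.

End Typical.

(** * Sublinear errors and subadditivity up to square roots *)

Section Sublinear.
Variable R : realType.

(** The condition [e n = o(n)] without division: [C] absorbs the small values of [n]. *)
Definition sublin (e : nat -> R) :=
  forall eps : R, 0 < eps -> exists C : R, forall n, `|e n| <= eps * n%:R + C.

Lemma sublinD e f : sublin e -> sublin f -> sublin (fun n => e n + f n).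
Proof.
move=> he hf eps e0; have e2 : 0 < eps / 2 by lra.
have [C hC] := he _ e2; have [D hD] := hf _ e2; exists (C + D) => n.
apply: le_trans (ler_normD _ _) _; have := hC n; have := hD n; lra.
Qed.

Lemma sublinN e : sublin e -> sublin (fun n => - e n).
Proof. by move=> he eps /he[C hC]; exists C => n; rewrite normrN. Qed.

Lemma sublinZ c e : sublin e -> sublin (fun n => c * e n).
Proof.
move=> he eps e0; have c0 : 0 < `|c| + 1 by rewrite ltr_wpDl.
have [C hC] := he _ (divr_gt0 e0 c0); exists ((`|c| + 1) * C) => n.
rewrite normrM; apply: (@le_trans _ _ ((`|c| + 1) * `|e n|)).
  by rewrite ler_wpM2r// lerDl.
apply: le_trans (ler_wpM2l (ltW c0) (hC n)) _.
by rewrite mulrDr mulrA mulrCA divff ?mulr1// gt_eqF.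
Qed.

Lemma sublin_cst c : sublin (fun=> c).
Proof. by move=> eps e0; exists `|c| => n; rewrite lerDr mulr_ge0// ltW. Qed.

Lemma sqrt_le_lin (x eps : R) : 0 <= x -> 0 < eps -> Num.sqrt x <= eps * x + eps^-1.
Proof.
move=> x0 e0; have := sqr_sqrtr x0; have := sqrtr_ge0 x; set s := Num.sqrt x => s0 <-.
have i0 : 0 < eps^-1 by rewrite invr_gt0.
have ei : eps * eps^-1 = 1 by rewrite divff// gt_eqF.
set z := eps^-1 in i0 ei *.
have : 0 <= eps * (s - z) ^+ 2 by rewrite mulr_ge0 ?sqr_ge0// ltW.
have -> : eps * (s - z) ^+ 2 = eps * s ^+ 2 - 2 * (eps * z) * s + (eps * z) * z by ring.
rewrite ei; lra.
Qed.

Lemma sublin_sqrt (k : nat) : sublin (fun n => Num.sqrt (n + k)%:R).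
Proof.
move=> eps e0; exists (eps * k%:R + eps^-1) => n.
rewrite ger0_norm ?sqrtr_ge0//; apply: le_trans (sqrt_le_lin (ler0n _ _) e0) _.
by rewrite natrD mulrDr addrA.
Qed.

Lemma sublin_lin0 (x : R) : (forall eps : R, 0 < eps -> exists C : R, forall n : nat,
   x * n%:R <= eps * n%:R + C) -> x <= 0.
Proof.
move=> h; rewrite leNgt; apply/negP => x0.
have [C hC] := h (x / 2) ltac:(lra).
have := hC (Num.truncn (2 * C / x)).+1.
have := truncnS_gt (2 * C / x); set n := _.+1%:R.
rewrite ltr_pdivrMr//; lra.
Qed.

Lemma sublin_cvg (e : nat -> R) (l : R) : sublin (fun n => e n - l * n%:R) ->
  (fun n => e n / n%:R) @ \oo --> l.
Proof.
move=> he; apply/cvgrPdist_le => eps e0.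
have [C hC] := he (eps / 2) ltac:(lra).
have [C0|C0] := leP 0 C; last first.
  exists 1%N => // n /= n1; have n0 : 0 < n%:R :> R by rewrite ltr0n.
  rewrite -(ler_pM2r n0) -{2}(gtr0_norm n0) -normrM mulrBl divfK ?gt_eqF// distrC.
  have := hC n; have : 0 <= eps * n%:R by rewrite mulr_ge0// ltW.
  lra.
exists (Num.truncn (2 * C / eps)).+1 => // n /= nN.
have n0 : 0 < n%:R :> R by rewrite ltr0n; lia.
rewrite -(ler_pM2r n0) -{2}(gtr0_norm n0) -normrM mulrBl divfK ?gt_eqF// distrC.
have : 2 * C / eps < n%:R.
  by apply: lt_le_trans (truncnS_gt _) _; rewrite ler_nat.
rewrite ltr_pdivrMr// => h2; have := hC n; lra.
Qed.

Section Fekete.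
Variables (al : nat -> R) (Q D : R).
Hypothesis Q0 : 0 <= Q.
Hypothesis D0 : 0 <= D.
Hypothesis al_sub : forall n k, (0 < n)%N -> (0 < k)%N ->
  al (n + k)%N <= al n + al k + Q * (Num.sqrt n%:R + Num.sqrt k%:R).
Hypothesis al_mono : forall n k, (0 < n + k)%N ->
  al n <= al (n + k)%N + D * k%:R + D * Num.sqrt (n + k)%:R.
Hypothesis al_low : forall n, (0 < n)%N -> - (D * Num.sqrt n%:R) <= al n.

(* Adding [4 Q sqrt n] absorbs the square-root error, but only when the two
   summands are comparable; hence the balanced splitting in [fekete_mul]. *)
Let b n := al n + 4 * Q * Num.sqrt n%:R.

Lemma fekete_balanced n k : (0 < n)%N -> (0 < k)%N -> (n <= 2 * k)%N -> (k <= 2 * n)%N ->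
  b (n + k) <= b n + b k.
Proof.
move=> n0 k0 nk kn; have := al_sub n0 k0; rewrite /b.
(* Balance leaves a gain of [sqrt n + sqrt k] in four times the concavity defect of the root,
   exactly the error in [al_sub]. *)
suff : 4 * Num.sqrt (n + k)%:R <= 3 * (Num.sqrt n%:R + Num.sqrt k%:R) :> R.
  set x := Num.sqrt _; set y := Num.sqrt _; set z := Num.sqrt _ => h.
  have := ler_wpM2l Q0 h; lra.
have h1 : n%:R <= 2 * k%:R :> R by rewrite -natrM ler_nat.
have h2 : k%:R <= 2 * n%:R :> R by rewrite -natrM ler_nat.
have n1 : 0 <= n%:R :> R by []. have k1 : 0 <= k%:R :> R by [].
have := sqr_sqrtr n1; have := sqr_sqrtr k1; have nk1 : 0 <= (n + k)%:R :> R by [].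
have := sqr_sqrtr nk1; rewrite natrD.
have := sqrtr_ge0 (n%:R : R); have := sqrtr_ge0 (k%:R : R); have := sqrtr_ge0 (n%:R + k%:R : R).
set z := Num.sqrt (_ + _); set x := Num.sqrt n%:R; set y := Num.sqrt k%:R.
move=> z0 y0 x0 zz yy xx.
rewrite -ler_sqr ?nnegrE ?mulr_ge0 ?addr_ge0//.
have e1 : x ^+ 2 <= 2 * y ^+ 2 by rewrite xx yy.
have e2 : y ^+ 2 <= 2 * x ^+ 2 by rewrite xx yy.
(* [3 / 2] is a rational bound for [sqrt 2], the largest possible ratio of the roots. *)
have xy : x <= 3 / 2 * y by rewrite -ler_sqr ?nnegrE ?mulr_ge0//; nra.
have yx : y <= 3 / 2 * x by rewrite -ler_sqr ?nnegrE ?mulr_ge0//; nra.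
have : 0 <= (3 / 2 * y - x) * (3 / 2 * x - y) by rewrite mulr_ge0 ?subr_ge0.
rewrite exprMn zz -xx -yy; nra.
Qed.

Lemma fekete_mul N k : (0 < N)%N -> (0 < k)%N -> b (k * N) <= k%:R * b N.
Proof.
move=> N0; have [u] := ubnP k; elim: u k => // u IH k ku k0.
have [->|k1] := eqVneq k 1%N; first by rewrite mul1n mul1r.
have kE : k = (k./2 + (k - k./2))%N by lia.
have kR : k%:R = (k./2)%:R + (k - k./2)%:R :> R by rewrite -natrD -kE.
have IH1 : b (k./2 * N) <= (k./2)%:R * b N by apply: IH; lia.
have IH2 : b ((k - k./2) * N) <= (k - k./2)%:R * b N by apply: IH; lia.
have bal : b (k./2 * N + (k - k./2) * N) <= b (k./2 * N) + b ((k - k./2) * N).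
  by apply: fekete_balanced; rewrite ?muln_gt0 ?N0 ?andbT ?mulnA ?leq_pmul2r//; lia.
by rewrite kR mulrDl {1}kE mulnDl; lra.
Qed.

(** The constant is the infimum of [b N / N], which gives the lower bound at once. For the upper
    bound a nearly optimal [N] is fixed, [n] is rounded up to a multiple of [N], and [al_mono] leads
    back to [n]. *)
Lemma fekete : exists l : R, sublin (fun n => al n - l * n%:R).
Proof.
pose S := [set b N / N%:R | N in [set N | (0 < N)%N]].
have S0 : S !=set0 by exists (b 1 / 1%:R), 1%N.
have sq n : Num.sqrt n%:R <= n%:R :> R.
  case: n => [|n]; first by rewrite sqrtr0.
  rewrite -ler_sqr ?nnegrE ?sqrtr_ge0// sqr_sqrtr//.
  by rewrite expr2 ler_peMr// ler1n.
have Slb : has_lbound S.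
  exists (- D) => _ [N /= N0 <-].
  rewrite ler_pdivlMr ?ltr0n// mulNr /b.
  have := al_low N0; have := ler_wpM2l D0 (sq N).
  have : 0 <= 4 * Q * Num.sqrt (N%:R : R) by rewrite !mulr_ge0 ?sqrtr_ge0.
  lra.
exists (inf S) => eps e0; set l := inf S.
have low n : (0 < n)%N -> l * n%:R - 4 * Q * Num.sqrt n%:R <= al n.
  move=> n0; have : l <= b n / n%:R by apply: ge_inf => //; exists n.
  rewrite ler_pdivlMr ?ltr0n// /b; lra.
have e4 : 0 < eps / 4 by lra.
have [_ [N /= N0 <-] hN] := inf_adherent e4 (conj S0 Slb).
have {}hN : b N <= (l + eps / 4) * N%:R.
  by rewrite -ler_pdivrMr ?ltr0n// ltW.
have [C1 hC1] := sublinZ (4 * Q) (@sublin_sqrt 0) e0.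
have [C2 hC2] := sublinZ D (@sublin_sqrt N) e4.
pose C := `|al 0| + `|C1| + `|C2| + D * N%:R + `|l + eps / 4| * N%:R + eps * N%:R.
exists C => n.
have C1' := ler_norm C1; have C2' := ler_norm C2.
have DN : 0 <= D * N%:R by rewrite mulr_ge0.
have lN : 0 <= `|l + eps / 4| * N%:R by rewrite mulr_ge0.
have eN : 0 <= eps * N%:R by rewrite mulr_ge0// ltW.
have en : 0 <= eps * n%:R by rewrite mulr_ge0// ltW.
have a0 := normr_ge0 (al 0); have c10 := normr_ge0 C1; have c20 := normr_ge0 C2.
have [->|n0] := posnP n; first by rewrite mulr0 subr0 mulr0 /C; lra.
rewrite ler_norml; apply/andP; split.
  have := low n n0; have := hC1 n; rewrite addn0 ler_norml => /andP[_].
  rewrite /C; lra.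
have [k k0 [kn kn']] : exists2 k, (0 < k)%N & (n <= k * N)%N /\ (k * N <= n + N)%N.
  exists (n %/ N).+1 => //; split; first by exact: ltnW (ltn_ceil n N0).
  by rewrite mulSn addnC leq_add2r leq_trunc_div.
have := @al_mono n (k * N - n)%N; rewrite subnKC// (leq_trans n0 kn) => /(_ isT) h1.
have h2 : D * (k * N - n)%:R <= D * N%:R by rewrite ler_wpM2l// ler_nat leq_subLR.
have h3 : D * Num.sqrt (k * N)%:R <= D * Num.sqrt (n + N)%:R.
  by rewrite ler_wpM2l// ler_sqrt ?ler_nat.
have h4 : al (k * N)%N <= b (k * N)%N by rewrite /b lerDl !mulr_ge0 ?sqrtr_ge0.
have h5 : b (k * N)%N <= k%:R * b N by exact: fekete_mul.
have h6 : k%:R * b N <= k%:R * ((l + eps / 4) * N%:R) by rewrite ler_wpM2l.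
have h7 : k%:R * ((l + eps / 4) * N%:R) <= (l + eps / 4) * n%:R + `|l + eps / 4| * N%:R.
  have -> : k%:R * ((l + eps / 4) * N%:R) = (l + eps / 4) * n%:R + (l + eps / 4) * (k * N - n)%:R.
    by rewrite natrB// natrM; ring.
  rewrite lerD2l; apply: (@le_trans _ _ (`|l + eps / 4| * (k * N - n)%:R)).
    by rewrite ler_wpM2r// ler_norm.
  by rewrite ler_wpM2l// ler_nat leq_subLR.
have := hC2 n; rewrite ler_norml => /andP[_ h8]; rewrite /C; lra.
Qed.

End Fekete.
End Sublinear.

(** * The time constant *)

Section TimeConstant.
Variable R : realType.

Lemma idistE (m m' : int) : idist R m m' = `|m%:~R - m'%:~R|.
Proof. by rewrite /idist intr_norm intrB. Qed.

Lemma ceil_dist (x : R) : `|(Num.ceil x)%:~R - x| <= 1.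
Proof.
have := ceil_ge x; have := gt_pred_ceil x; rewrite intrB => h1 h2.
by rewrite ler_norml; apply/andP; split; lra.
Qed.

Lemma sublin_comp (e : nat -> R) (k : nat -> nat) : (forall n, (k n <= n)%N) ->
  sublin e -> sublin (fun n => e (k n)).
Proof.
move=> kn he eps e0; have [C hC] := he _ e0; exists C => n.
by apply: le_trans (hC _) _; rewrite lerD2r ler_pM2l// ler_nat.
Qed.

(** The device by which each property of the time constant is read off from the corresponding
    property of [a] with sublinear error. *)
Lemma sublin_cmp (e : nat -> R) (x : R) : sublin e -> (forall n, x * n%:R <= e n) -> x <= 0.
Proof.
move=> he h; apply: sublin_lin0 => eps /he[C hC]; exists C => n.
exact: le_trans (h n) (le_trans (ler_norm _) (hC n)).
Qed.

Lemma sqrtD_le (x y : R) : 0 <= x -> 0 <= y ->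
  Num.sqrt (x + y) <= Num.sqrt x + Num.sqrt y.
Proof.
move=> x0 y0; rewrite -ler_sqr ?nnegrE ?addr_ge0 ?sqrtr_ge0//.
rewrite sqr_sqrtr ?addr_ge0// sqrrD !sqr_sqrtr//.
by have := mulr_ge0 (sqrtr_ge0 x) (sqrtr_ge0 y); lra.
Qed.

Variable C : R.
Hypothesis C_ge0 : 0 <= C.
Local Notation fl := (fluct C).
Variable a : nat -> int -> R.
Hypothesis a_triangle : forall n1 n2 m1 m2, a (n1 + n2) (m1 + m2) <=
  a n1 m1 + a n2 m2 + fl n1 + fl n2 + fl (n1 + n2).
Hypothesis a_lip : forall n m m', a n m' <= a n m + idist R m' m + fl n + fl n.
Hypothesis a_mono : forall n k m, a n m <= a (n + k) m + fl n + fl (n + k).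
Hypothesis a_opp : forall n m, a n m <= a n (- m) + fl n + fl n.
Hypothesis a_lower : forall n m, - fl n <= a n m.

Lemma sublin_fluct : sublin fl.
Proof.
apply: sublinD (sublin_cst _); apply: sublinZ => eps e0.
by have [D hD] := sublin_sqrt 1 e0; exists D => n; rewrite -addn1; exact: hD.
Qed.

(** Chosen for [fl n <= F * sqrt n] at positive [n], from [sqrt (n + 1) <= 2 * sqrt n] and
    [1 <= sqrt n]. *)
Let F : R := 2 * (8 * C + 1) + 1.

Let F_ge0 : 0 <= F. Proof. by rewrite /F; have := C_ge0; lra. Qed.

Let sqrt_ge1 n : (0 < n)%N -> 1 <= Num.sqrt n%:R :> R.
Proof. by move=> n0; rewrite -[X in X <= _]sqrtr1 ler_sqrt ?ler1n. Qed.

Let fl_le n : (0 < n)%N -> fl n <= F * Num.sqrt n%:R.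
Proof.
move=> n0; have s1 := sqrt_ge1 n0.
have : Num.sqrt n.+1%:R <= 2 * Num.sqrt n%:R :> R.
  by rewrite -natr1; have := sqrtD_le (ler0n R n) (@ler01 R); rewrite sqrtr1; lra.
have C1 : 0 <= 8 * C + 1 by have := C_ge0; lra.
rewrite /fluct /F => /(ler_wpM2l C1); set y := Num.sqrt n.+1%:R; set x := Num.sqrt n%:R in s1 *.
lra.
Qed.

Let fl_mono n k : fl n <= fl (n + k).
Proof.
rewrite /fluct lerD2r ler_wpM2l//; first by have := C_ge0; lra.
by rewrite ler_sqrt ?ler_nat//; lia.
Qed.

Lemma time_constant_exists (v : R) :
  exists l : R, sublin (fun n => a n (Num.ceil (v * n%:R)) - l * n%:R).
Proof.
apply: (@fekete R (fun n => a n (Num.ceil (v * n%:R))) (4 * F + 3) (`|v| + 4 * F + 2)).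
- by have := F_ge0; lra.
- by have := F_ge0; have := normr_ge0 v; lra.
(* The triangle costs [fl n + fl k + fl (n + k)], moving the endpoint [2 * fl (n + k)], and the
   three ceilings at most 3; together these give [4 * F + 3]. *)
- move=> n k n0 k0.
  have h1 := a_triangle n k (Num.ceil (v * n%:R)) (Num.ceil (v * k%:R)).
  have h2 := a_lip (n + k) (Num.ceil (v * n%:R) + Num.ceil (v * k%:R)) (Num.ceil (v * (n + k)%:R)).
  have h3 : idist R (Num.ceil (v * (n + k)%:R)) (Num.ceil (v * n%:R) + Num.ceil (v * k%:R)) <= 3.
    rewrite idistE intrD; have := ceil_dist (v * (n + k)%:R).
    have := ceil_dist (v * n%:R); have := ceil_dist (v * k%:R); rewrite natrD mulrDr.
    by rewrite !ler_norml; set x := (Num.ceil _)%:~R; set y := (Num.ceil _)%:~R; set z := (Num.ceil _)%:~R; lra.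
  have s1 := sqrt_ge1 n0; have s2 := sqrt_ge1 k0.
  have f1 := fl_le n0; have f2 := fl_le k0.
  have f3 := @fl_le (n + k) ltac:(lia).
  have := sqrtD_le (ler0n R n) (ler0n R k); rewrite -natrD => /(ler_wpM2l F_ge0) f4.
  set x := Num.sqrt n%:R in s1 f1 f4 *; set y := Num.sqrt k%:R in s2 f2 f4 *.
  have : (4 * F + 3) * (x + y) = 4 * (F * (x + y)) + 3 * x + 3 * y by ring.
  rewrite mulrDr in f4 *; lra.
- move=> n k nk.
  have h1 := a_mono n k (Num.ceil (v * n%:R)).
  have h2 := a_lip (n + k) (Num.ceil (v * (n + k)%:R)) (Num.ceil (v * n%:R)).
  have h3 : idist R (Num.ceil (v * n%:R)) (Num.ceil (v * (n + k)%:R)) <= `|v| * k%:R + 2.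
    rewrite idistE; have := ceil_dist (v * (n + k)%:R).
    have := ceil_dist (v * n%:R); have := ler_norm (v * k%:R); have := ler_norm (- (v * k%:R)).
    rewrite normrN normrM [`|k%:R|]ger0_norm// natrD mulrDr.
    by rewrite !ler_norml; set x := (Num.ceil _)%:~R; set y := (Num.ceil _)%:~R; lra.
  have s1 := sqrt_ge1 nk; have f1 := fl_le nk; have f2 := fl_mono n k.
  set x := Num.sqrt (n + k)%:R in s1 f1 *.
  have k0 : 0 <= k%:R :> R by [].
  have := mulr_ge0 F_ge0 k0; have := mulr_ge0 (normr_ge0 v) (le_trans ler01 s1).
  set Fx := F * x in f1; set Fk := F * k%:R; set vx := `|v| * x; set vk := `|v| * k%:R in h3.
  have -> : (`|v| + 4 * F + 2) * k%:R = vk + 4 * Fk + 2 * k%:R by rewrite /vk /Fk; ring.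
  have -> : (`|v| + 4 * F + 2) * x = vx + 4 * Fx + 2 * x by rewrite /vx /Fx; ring.
  lra.
- move=> n n0; have := a_lower n (Num.ceil (v * n%:R)); have := fl_le n0.
  have := F_ge0; have := normr_ge0 v; have := sqrt_ge1 n0; set x := Num.sqrt _; nra.
Qed.

(** Negative slopes are included from the start, since the downward shear leads to [v - 1]. The
    Lipschitz constant 1 is the weight of a vertical edge. *)
Lemma time_constant : exists lam : R -> R, [/\
  forall v, sublin (fun n => a n (Num.ceil (v * n%:R)) - lam v * n%:R),
  forall v, lam (- v) = lam v,
  forall u v, lam u - lam v <= `|u - v| &
  forall t u v, 0 <= t <= 1 ->
    lam (t * u + (1 - t) * v) <= t * lam u + (1 - t) * lam v].
Proof.
have [lam hl] := boolp.choice time_constant_exists.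
exists lam.
have even1 v : lam (- v) <= lam v.
  rewrite -subr_le0; apply: (@sublin_cmp (fun n =>
    - (a n (Num.ceil (- v * n%:R)) - lam (- v) * n%:R) +
    (a n (Num.ceil (v * n%:R)) - lam v * n%:R) + (4 * fl n + 2))).
    apply: sublinD; first by apply: sublinD => //; exact: sublinN.
    by apply: sublinD (sublin_cst _); apply: sublinZ; exact: sublin_fluct.
  move=> n; have h1 := a_opp n (Num.ceil (- v * n%:R)).
  have h2 := a_lip n (Num.ceil (v * n%:R)) (- Num.ceil (- v * n%:R)).
  have h3 : idist R (- Num.ceil (- v * n%:R)) (Num.ceil (v * n%:R)) <= 2.
    rewrite idistE intrN; have := ceil_dist (v * n%:R).
    have := ceil_dist (- v * n%:R); rewrite !ler_norml.
    by set x := (Num.ceil _)%:~R; set y := (Num.ceil _)%:~R; lra.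
  lra.
split => //.
- by move=> v; apply/eqP; rewrite eq_le even1 /= -{1}[v]opprK even1.
- move=> u v; rewrite -subr_le0; apply: (@sublin_cmp (fun n =>
    - (a n (Num.ceil (u * n%:R)) - lam u * n%:R) +
    (a n (Num.ceil (v * n%:R)) - lam v * n%:R) + (2 * fl n + 2))).
    apply: sublinD; first by apply: sublinD => //; exact: sublinN.
    by apply: sublinD (sublin_cst _); apply: sublinZ; exact: sublin_fluct.
  move=> n; have h2 := a_lip n (Num.ceil (v * n%:R)) (Num.ceil (u * n%:R)).
  have h3 : idist R (Num.ceil (u * n%:R)) (Num.ceil (v * n%:R)) <= `|u - v| * n%:R + 2.
    rewrite idistE; have := ceil_dist (v * n%:R); have := ceil_dist (u * n%:R).
    have := ler_norm ((u - v) * n%:R); have := ler_norm (- ((u - v) * n%:R)).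
    rewrite normrN normrM [`|n%:R|]ger0_norm// !ler_norml.
    by set x := (Num.ceil _)%:~R; set y := (Num.ceil _)%:~R; lra.
  lra.
move=> t u v /andP[t0 t1]; rewrite -subr_le0.
(* Convexity: the first [n1 n] columns are crossed with slope [u], the other [n2 n] with slope
   [v]. *)
pose n1 n := Num.truncn (t * n%:R); pose n2 n := (n - n1 n)%N.
have n1b n : (n1 n)%:R <= t * n%:R < (n1 n)%:R + 1.
  by rewrite natr1; apply: truncn_itv; rewrite mulr_ge0.
have n1n n : (n1 n <= n)%N.
  rewrite -(ler_nat R); have /andP[h _] := n1b n; apply: le_trans h _.
  by rewrite ler_piMl.
have n2n n : (n2 n <= n)%N by rewrite leq_subr.
pose vv := t * u + (1 - t) * v.
apply: (@sublin_cmp (fun n => - (a n (Num.ceil (vv * n%:R)) - lam vv * n%:R) +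
   (a (n1 n) (Num.ceil (u * (n1 n)%:R)) - lam u * (n1 n)%:R) +
   (a (n2 n) (Num.ceil (v * (n2 n)%:R)) - lam v * (n2 n)%:R) +
   (fl (n1 n) + fl (n2 n) + 3 * fl n + (`|u| + `|v| + `|lam u| + `|lam v| + 3)))).
  apply: sublinD; first apply: sublinD; first apply: sublinD.
  - exact: sublinN.
  - exact: (@sublin_comp (fun n => a n (Num.ceil (u * n%:R)) - lam u * n%:R)).
  - exact: (@sublin_comp (fun n => a n (Num.ceil (v * n%:R)) - lam v * n%:R)).
  apply: sublinD (sublin_cst _); apply: sublinD; first apply: sublinD.
  - exact: sublin_comp sublin_fluct.
  - exact: sublin_comp sublin_fluct.
  - by apply: sublinZ; exact: sublin_fluct.
move=> n.
have h1 := a_triangle (n1 n) (n2 n) (Num.ceil (u * (n1 n)%:R)) (Num.ceil (v * (n2 n)%:R)).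
rewrite {1 4}/n2 !subnKC// in h1.
have h2 := a_lip n (Num.ceil (u * (n1 n)%:R) + Num.ceil (v * (n2 n)%:R)) (Num.ceil (vv * n%:R)).
have n2E : (n2 n)%:R = n%:R - (n1 n)%:R :> R by rewrite natrB.
have /andP[b1 b2] := n1b n.
pose r := t * n%:R - (n1 n)%:R.
have r01 : `|r| <= 1 by rewrite ler_norml /r; apply/andP; split; lra.
have mulr1_le (c : R) : `|c * r| <= `|c| by rewrite normrM ler_piMr.
have h3 : idist R (Num.ceil (vv * n%:R))
    (Num.ceil (u * (n1 n)%:R) + Num.ceil (v * (n2 n)%:R)) <= `|u| + `|v| + 3.
  rewrite idistE intrD; have := ceil_dist (vv * n%:R).
  have := ceil_dist (u * (n1 n)%:R); have := ceil_dist (v * (n2 n)%:R).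
  have := mulr1_le u; have := mulr1_le v.
  have -> : vv * n%:R = u * (n1 n)%:R + v * (n2 n)%:R + u * r - v * r.
    by rewrite n2E /vv /r; ring.
  rewrite !ler_norml.
  set x := (Num.ceil _)%:~R; set y := (Num.ceil _)%:~R; set z := (Num.ceil _)%:~R.
  lra.
have h4 : lam u * (n1 n)%:R + lam v * (n2 n)%:R <=
   (t * lam u + (1 - t) * lam v) * n%:R + `|lam u| + `|lam v|.
  have -> : (t * lam u + (1 - t) * lam v) * n%:R =
     lam u * (n1 n)%:R + lam v * (n2 n)%:R + lam u * r - lam v * r.
    by rewrite n2E /r; ring.
  have := mulr1_le (lam u); have := mulr1_le (lam v); rewrite !ler_norml; lra.
rewrite -/vv mulrBl; lra.
Qed.

End TimeConstant.

(** * Almost sure convergence *)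

Section AlmostSure.
Variable R : realType.

(** Almost monotonicity bounds [f n] above by its value at the next square and below by that at the
    previous one. The gap [2 * k + 1] is of order [sqrt n]. *)
Lemma sublin_squares (f : nat -> R) (l D : R) : 0 <= D ->
  (forall n k, f n <= f (n + k)%N + D * k%:R + D) ->
  (forall eps : R, 0 < eps -> exists C : R, forall k : nat,
     `|f (k ^ 2)%N - l * (k ^ 2)%:R| <= eps * (k ^ 2)%:R + C) ->
  sublin (fun n => f n - l * n%:R).
Proof.
move=> D0 fm fs eps e0; have [C hC] := fs (eps / 4) ltac:(lra).
pose B := `|l| + D + eps / 4.
have B0 : 0 <= B by rewrite /B; have := normr_ge0 l; lra.
exists (B + 2 * B ^+ 2 / eps + C + D) => n.
have [k kn nk] : exists2 k, (k ^ 2 <= n)%N & (n < k.+1 ^ 2)%N.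
  elim: n => [|n [k kn nk]]; first by exists 0%N.
  have [h|h] := ltnP n.+1 (k.+1 ^ 2); first by exists k => //; lia.
  by exists k.+1 => //; rewrite -!mulnn in nk h *; nia.
have kE : (k.+1 ^ 2)%:R = (k ^ 2)%:R + 2 * k%:R + 1 :> R.
  by rewrite !natrX -natr1; ring.
have h1 := fm n (k.+1 ^ 2 - n)%N; rewrite subnKC in h1; last exact: ltnW.
have h2 := fm (k ^ 2)%N (n - k ^ 2)%N; rewrite subnKC// in h2.
have := hC k; have := hC k.+1; rewrite !ler_norml => /andP[_ u1] /andP[u2 _].
have knR : (k ^ 2)%:R <= n%:R :> R by rewrite ler_nat.
have nkR : n%:R <= (k.+1 ^ 2)%:R :> R by rewrite ler_nat ltnW.
rewrite natrB ?(ltnW nk)// in h1; rewrite natrB// in h2.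
(* Completing the square turns an error linear in [k] into a small multiple of [k ^ 2] plus a
   constant. *)
have BE : B * (2 * k%:R + 1) <= eps / 2 * (k ^ 2)%:R + B + 2 * B ^+ 2 / eps.
  rewrite natrX; set x := k%:R.
  have ei : eps * eps^-1 = 1 by rewrite divff// gt_eqF.
  have : 0 <= eps / 2 * (x - 2 * B / eps) ^+ 2.
    by rewrite mulr_ge0 ?sqr_ge0// ltW// divr_gt0.
  have -> : eps / 2 * (x - 2 * B / eps) ^+ 2 =
     eps / 2 * x ^+ 2 - 2 * B * x * (eps * eps^-1) + 2 * B ^+ 2 / eps * (eps * eps^-1).
    by field; rewrite gt_eqF.
  rewrite ei !mulr1 /=; set z := 2 * B ^+ 2 / eps; lra.
set z := 2 * B ^+ 2 / eps in BE *.
set K2 := (k ^ 2)%:R in knR nkR kE h1 h2 u1 u2 BE *.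
set K3 := (k.+1 ^ 2)%:R in nkR kE h1 h2 u1 u2 *.
set nn := n%:R in knR nkR h1 h2 *.
have kk : 0 <= k%:R :> R by [].
have e2 : eps / 2 * K2 <= eps / 2 * nn by rewrite ler_wpM2l//; lra.
have l1 : l * (K3 - nn) <= `|l| * (2 * k%:R + 1).
  apply: (@le_trans _ _ (`|l| * (K3 - nn))).
    by rewrite ler_wpM2r ?subr_ge0// ler_norm.
  by rewrite ler_wpM2l//; lra.
have l2 : l * (nn - K2) <= `|l| * (2 * k%:R + 1).
  apply: (@le_trans _ _ (`|l| * (nn - K2))).
    by rewrite ler_wpM2r ?subr_ge0// ler_norm.
  by rewrite ler_wpM2l//; lra.
have d1 : D * (K3 - nn) <= D * (2 * k%:R + 1) by rewrite ler_wpM2l//; lra.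
have d2 : D * (nn - K2) <= D * (2 * k%:R + 1) by rewrite ler_wpM2l//; lra.
have E1 : eps / 4 * K3 <= eps / 4 * nn + eps / 4 * (2 * k%:R + 1).
  by rewrite -mulrDr ler_wpM2l//; lra.
have E2 : eps / 4 * K2 <= eps / 4 * nn by rewrite ler_wpM2l//; lra.
have E3 : 0 <= eps / 4 * (2 * k%:R + 1) by rewrite mulr_ge0//; lra.
have BE2 : B * (2 * k%:R + 1) = `|l| * (2 * k%:R + 1) + D * (2 * k%:R + 1) + eps / 4 * (2 * k%:R + 1).
  by rewrite /B; ring.
have en : 0 <= eps * nn by rewrite mulr_ge0// ?ltW// /nn.
apply/andP; split; lra.
Qed.

Lemma sum_inv_sq (m : nat) : \sum_(k < m) (k.+1%:R ^+ 2)^-1 <= 2 :> R.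
Proof.
suff : \sum_(k < m) (k.+1%:R ^+ 2)^-1 <= 2 - 2 / m.+1%:R :> R.
  by move=> h; apply: le_trans h _; rewrite gerBl.
elim: m => [|m IH]; first by rewrite big_ord0 invr1; lra.
rewrite big_ord_recr /=.
suff : (m.+1%:R ^+ 2)^-1 <= 2 / m.+1%:R - 2 / m.+2%:R :> R.
  by move=> h; apply: le_trans (lerD IH h) _; rewrite addrA subrK.
have -> : m.+2%:R = m.+1%:R + 1 :> R by rewrite natr1.
have x1 : 1 <= m.+1%:R :> R by rewrite ler1n.
set x := m.+1%:R in x1 *; have x0 : 0 < x by lra.
have -> : 2 / x - 2 / (x + 1) = 2 / (x * (x + 1)) by field; apply/andP; split; rewrite gt_eqF//; lra.
rewrite ler_pdivlMr ?mulr_gt0//; last by lra.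
rewrite mulrC ler_pdivrMr ?exprn_gt0//; nra.
Qed.

Context (G : probability R R) (d : measure_display)
  (Omega : measurableType d) (P : probability Omega R).
Implicit Types w : pt2 -> {RV P >-> R}.
Hypothesis HGsupp : G [set x : R | 0 <= x] = 1%E.

Lemma ae_eventually_notin (E : nat -> set Omega) (c : R) : 0 <= c ->
  (forall k, measurable (E k)) ->
  (forall k, (P (E k) <= (c / k.+1%:R ^+ 2)%:E)%E) ->
  {ae P, forall om, exists K, forall k, (K <= k)%N -> ~ E k om}.
Proof.
move=> c0 mE PE; exists (lim_sup_set E); split.
- apply: bigcap_measurable => // k _; apply: bigcup_measurable => j _; exact: mE.
- apply: lim_sup_set_cvg0 => //.
  apply: (@le_lt_trans _ _ (c * 2)%:E); last exact: ltry.
  apply: lime_le; first by apply: is_cvg_nneseries.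
  apply: nearW => m; apply: (@le_trans _ _ (\sum_(0 <= k < m) (c / k.+1%:R ^+ 2)%:E)%E).
    by apply: lee_sum => k _; exact: PE.
  rewrite big_mkord sumEFin lee_fin -mulr_sumr ler_wpM2l//; exact: sum_inv_sq.
- move=> om /= /forallNP h k _.
  have := h k => /existsNP[j /not_implyP[kj /contrapT Ej]].
  by exists j.
Qed.

Variable C : R.
Hypothesis C_ge0 : 0 <= C.
Variable a : nat -> int -> R.
Hypothesis a_conc : forall n m w, iidG G w -> forall t : R, 0 < t ->
  exists E : set Omega, [/\ measurable E,
    (P E <= (C * n%:R / t ^+ 2 + (8 * n.+1%:R)^-1)%:E)%E &
    forall om, ~ E om -> wnneg (senv w om) ->
      `|Smin (senv w om) n m - a n m| <= t + 1].

Lemma Smin_ae_sublin w (v l : R) : iidG G w ->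
  sublin (fun n => a n (Num.ceil (v * n%:R)) - l * n%:R) ->
  {ae P, forall om, sublin (fun n => Smin (senv w om) n (Num.ceil (v * n%:R)) - l * n%:R)}.
Proof.
move=> iw al.
pose nk (k : nat) := (k.+1 ^ 2)%N.
(* The tolerances [1 / (j + 1)] are countable. At [n = (k + 1) ^ 2] and [t = n / (j + 1)] the
   Chebyshev term is [C * (j + 1) ^ 2 / (k + 1) ^ 2], summable in [k]. *)
have sq : {ae P, forall om, forall j : nat, exists K, forall k, (K <= k)%N ->
    wnneg (senv w om) -> `|Smin (senv w om) (nk k) (Num.ceil (v * (nk k)%:R)) -
      a (nk k) (Num.ceil (v * (nk k)%:R))| <= j.+1%:R^-1 * (nk k)%:R + 1}.
  apply/ae_foralln => j.
  pose t (k : nat) : R := j.+1%:R^-1 * (nk k)%:R.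
  have nk0 k : 0 < (nk k)%:R :> R by rewrite ltr0n expn_gt0.
  have t0 k : 0 < t k by rewrite mulr_gt0// invr_gt0.
  have [E hE] := boolp.choice (fun k => a_conc (nk k) (Num.ceil (v * (nk k)%:R)) iw (t0 k)).
  suff : {ae P, forall om, exists K, forall k, (K <= k)%N -> ~ E k om}.
    apply: filterS => om [K hK]; exists K => k Kk u0.
    have [_ _ h] := hE k; exact: h (hK k Kk) u0.
  apply: (@ae_eventually_notin E (C * j.+1%:R ^+ 2 + 1)).
  - by rewrite addr_ge0// mulr_ge0// sqr_ge0.
  - by move=> k; have [] := hE k.
  - move=> k; have [_ h _] := hE k; apply: le_trans h _; rewrite lee_fin.
    have nkE : (nk k)%:R = k.+1%:R ^+ 2 :> R by rewrite natrX.
    have x0 : 0 < k.+1%:R :> R by [].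
    rewrite [leRHS]mulrDl mul1r; apply: lerD.
      rewrite /t nkE; set x := k.+1%:R in x0 *; set y := j.+1%:R.
      have y0 : 0 < y by rewrite ltr0n.
      rewrite le_eqVlt; apply/orP; left; apply/eqP; field.
      by rewrite !gt_eqF.
    rewrite lef_pV2 ?posrE ?exprn_gt0 ?mulr_gt0// -nkE.
    by rewrite -natrM ler_nat; lia.
have := iidG_nonneg HGsupp iw; apply: filterS2 sq => om sq u0.
apply: (@sublin_squares _ l (`|v| + 2)).
- by rewrite addr_ge0.
- move=> n k; have h1 := Smin_mono u0 n k (Num.ceil (v * n%:R)).
  have h2 := Smin_lip u0 (n + k) (Num.ceil (v * (n + k)%:R)) (Num.ceil (v * n%:R)).
  have h3 : idist R (Num.ceil (v * n%:R)) (Num.ceil (v * (n + k)%:R)) <= `|v| * k%:R + 2.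
    rewrite idistE; have := ceil_dist (v * (n + k)%:R).
    have := ceil_dist (v * n%:R); have := ler_norm (v * k%:R); have := ler_norm (- (v * k%:R)).
    rewrite normrN normrM [`|k%:R|]ger0_norm// natrD mulrDr.
    by rewrite !ler_norml; set x := (Num.ceil _)%:~R; set y := (Num.ceil _)%:~R; lra.
  have k0 : 0 <= k%:R :> R by [].
  have := normr_ge0 v; lra.
move=> eps e0.
pose j := Num.truncn (2 / eps).
have je : j.+1%:R^-1 <= eps / 2.
  rewrite -[eps / 2]invrK lef_pV2 ?posrE ?invr_gt0 ?divr_gt0//.
  by rewrite invf_div; exact/ltW/truncnS_gt.
have [K hK] := sq j; have [D hD] := al (eps / 2) ltac:(lra).
pose S k := Smin (senv w om) (k ^ 2)%N (Num.ceil (v * (k ^ 2)%:R)).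
(* Accounts for the finitely many squares below the random threshold. *)
pose D' := \sum_(i < K.+1) `|S i - l * (i ^ 2)%:R|.
have D'0 : 0 <= D' by apply: sumr_ge0.
exists (D' + `|D| + 1) => k.
have D0 := normr_ge0 D; have Dn := ler_norm D.
have [kK|kK] := leqP k K.
  have kK1 : (k < K.+1)%N by [].
  have : `|S k - l * (k ^ 2)%:R| <= D'.
    by rewrite /D' (bigD1 (Ordinal kK1))//= lerDl; apply: sumr_ge0.
  have : 0 <= eps * (k ^ 2)%:R by rewrite mulr_ge0// ltW.
  rewrite /S; lra.
case: k kK => // k kK; have := hK k kK u0; have := hD (nk k); rewrite /nk.
have : j.+1%:R^-1 * (k.+1 ^ 2)%:R <= eps / 2 * (k.+1 ^ 2)%:R by rewrite ler_wpM2r.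
set x := Smin _ _ _; set y := a _ _; set z := j.+1%:R^-1 * _; set n := (_ ^ 2)%:R.
rewrite !ler_norml => h1 /andP[h2 h3] /andP[h4 h5]; apply/andP; split; lra.
Qed.

End AlmostSure.

(** * One-sided derivatives and the shear *)

Section ConvexDerivatives.
Variables (R : realType) (lam : R -> R).
Hypothesis lam_lip : forall u v, lam u - lam v <= `|u - v|.
Hypothesis lam_convex : forall t u v, 0 <= t <= 1 ->
  lam (t * u + (1 - t) * v) <= t * lam u + (1 - t) * lam v.

Lemma three_point x y z : x <= y -> y <= z ->
  (z - x) * lam y <= (z - y) * lam x + (y - x) * lam z.
Proof.
move=> xy yz; have [zx|zx] := eqVneq z x.
  by have -> : y = x by [lra]; rewrite zx !subrr !mul0r addr0.
have zx0 : 0 < z - x by rewrite subr_gt0 lt_neqAle eq_sym zx /=; lra.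
have := @lam_convex ((z - y) / (z - x)) x z.
rewrite ler_pdivlMr// mul0r ler_pdivrMr// mul1r subr_ge0 yz /= lerD2l lerN2 xy => /(_ isT).
have -> : (z - y) / (z - x) * x + (1 - (z - y) / (z - x)) * z = y.
  by field; rewrite gt_eqF.
move=> /(ler_wpM2l (ltW zx0)).
suff -> : (z - x) * ((z - y) / (z - x) * lam x + (1 - (z - y) / (z - x)) * lam z) =
  (z - y) * lam x + (y - x) * lam z by [].
by field; rewrite gt_eqF.
Qed.

Lemma slope_right v x y : v < x -> x <= y ->
  (lam x - lam v) / (x - v) <= (lam y - lam v) / (y - v).
Proof.
move=> vx xy; rewrite ler_pdivrMr ?subr_gt0// mulrAC ler_pdivlMr ?subr_gt0//; last by lra.
by have := three_point (ltW vx) xy; lra.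
Qed.

Lemma slope_left v x y : x <= y -> y < v ->
  (lam v - lam x) / (v - x) <= (lam v - lam y) / (v - y).
Proof.
move=> xy yv; rewrite ler_pdivrMr ?subr_gt0//; last by lra.
rewrite mulrAC ler_pdivlMr ?subr_gt0//.
by have := three_point xy (ltW yv); lra.
Qed.

(** The difference quotients decrease towards [v] by convexity and are bounded below by [-1] by the
    Lipschitz property, so the [lim] in [dplus] is a genuine limit. *)
Lemma dplus_le v : dplus lam v <= lam (v + 1) - lam v.
Proof.
rewrite /dplus; apply: limr_le.
  apply: nondecreasing_at_right_is_cvgr.
    apply: nearW => b x y xb yb xy; apply: slope_right => //.
    by move: xb; rewrite in_itv => /andP[].
  apply: nearW => b; exists (-1) => z [x]; rewrite /= in_itv /= => /andP[vx xb] <-.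
  rewrite ler_pdivlMr ?subr_gt0//; have := lam_lip v x.
  by rewrite ltr0_norm ?subr_lt0//; lra.
near=> x; have vx : v < x by near: x; exact: nbhs_right_gt.
have xv : x < v + 1 by near: x; apply: nbhs_right_lt; rewrite ltrDl.
apply: le_trans (slope_right vx (ltW xv)) _.
by have -> : v + 1 - v = 1 by [ring]; rewrite divr1.
Unshelve. all: by end_near. Qed.

Lemma dminus_ge v : lam v - lam (v - 1) <= dminus lam v.
Proof.
rewrite /dminus; apply: limr_ge.
  apply: nondecreasing_at_left_is_cvgr.
    apply: nearW => b x y xb yb xy; apply: slope_left => //.
    by move: yb; rewrite in_itv => /andP[].
  apply: nearW => b; exists 1 => z [x]; rewrite /= in_itv /= => /andP[bx xv] <-.
  rewrite ler_pdivrMr ?subr_gt0//; have := lam_lip v x.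
  by rewrite gtr0_norm ?subr_gt0//; lra.
near=> x; have xv : x < v by near: x; exact: nbhs_left_lt.
have vx : v - 1 < x by near: x; apply: nbhs_left_gt; rewrite ltrBlDr ltrDl.
apply: le_trans (slope_left (ltW vx) xv).
by have -> : v - (v - 1) = 1 by [ring]; rewrite divr1.
Unshelve. all: by end_near. Qed.

End ConvexDerivatives.

(** * Lower limits and the counts of up, right and down columns *)

Section Limits.
Variable R : realType.

Lemma limn_einf_ge (u : nat -> \bar R) (x : \bar R) (N : nat) :
  (forall n, (N <= n)%N -> (x <= u n)%E) -> (x <= limn_einf u)%E.
Proof.
move=> h; rewrite limn_einf_lim; apply: lime_ge; first exact: is_cvg_einfs.
exists N => // n /= Nn; apply: le_ereal_inf_tmp => _ [k /= nk <-].
exact: h (leq_trans Nn nk).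
Qed.

Lemma limn_einf_sublin (X e : nat -> R) (c : R) : sublin e ->
  (forall n, c * n%:R <= X n + e n) -> (c%:E <= limn_einf (fun n => (X n / n%:R)%:E))%E.
Proof.
move=> he hX; apply/lee_subgt0Pr => eps e0.
have [C hC] := he (eps / 2) ltac:(lra).
apply: (@limn_einf_ge _ _ (Num.truncn (2 * `|C| / eps)).+1) => n nN.
have n0 : 0 < n%:R :> R by rewrite ltr0n; lia.
rewrite -EFinB lee_fin ler_pdivlMr//.
have : 2 * `|C| / eps < n%:R.
  by apply: lt_le_trans (truncnS_gt _) _; rewrite ler_nat.
rewrite ltr_pdivrMr// => h2; have := hC n; have := hX n; have := ler_norm (e n).
have := ler_norm C; lra.
Qed.

Lemma count_iotaR (p : pred nat) n :
  (count p (iota 0 n))%:R = \sum_(k < n) (p k)%:R :> R.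
Proof.
elim: n => [|n IH]; first by rewrite big_ord0.
by rewrite -addn1 iotaD count_cat natrD IH add0n /= addn0 addn1 big_ord_recr.
Qed.

(** Lifting the next height by one lengthens the jump unless it goes down, so level columns count
    with the upward ones. In the downward shear they join the downward ones. *)
Lemma sum_idist_up p n m :
  \sum_(k < n.+1) (idist R (fpio p n m k.+1 + 1) (fpio p n m k) -
     idist R (fpio p n m k.+1) (fpio p n m k)) =
  (Ucnt p n m)%:R + (Rcnt p n m)%:R - (Dcnt p n m)%:R.
Proof.
rewrite /Ucnt /Rcnt /Dcnt !count_iotaR -big_split -sumrB; apply: eq_bigr => k _ /=.
move: (fpio p n m k.+1) (fpio p n m k) => b a; rewrite /idist -intrB.
have -> : `|b + 1 - a| - `|b - a| = (a < b)%R%:Z + (a == b)%:Z - (b < a)%R%:Z by lia.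
by rewrite intrB intrD.
Qed.

Lemma sum_idist_down p n m :
  \sum_(k < n.+1) (idist R (fpio p n m k.+1 - 1) (fpio p n m k) -
     idist R (fpio p n m k.+1) (fpio p n m k)) =
  - ((Ucnt p n m)%:R - (Rcnt p n m)%:R - (Dcnt p n m)%:R).
Proof.
rewrite /Ucnt /Rcnt /Dcnt !count_iotaR -!sumrB -sumrN; apply: eq_bigr => k _ /=.
move: (fpio p n m k.+1) (fpio p n m k) => b a; rewrite /idist -intrB.
have -> : `|b - 1 - a| - `|b - a| = - ((a < b)%R%:Z - (a == b)%:Z - (b < a)%R%:Z) by lia.
by rewrite intrN !intrB.
Qed.

End Limits.

(** * Identification of the time constant and the shear inequality *)

Section Main.
Context (R : realType) (G : probability R R) (d : measure_display)
  (Omega : measurableType d) (P : probability Omega R).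
Implicit Types w : pt2 -> {RV P >-> R}.
Hypothesis HGsupp : G [set x : R | 0 <= x] = 1%E.

(** [lam] comes before [w], so that original and sheared fields share it; [w0] supplies the typical
    outcomes from which the properties of [a] are derived. *)
Lemma ae_time_constant w0 : iidG G w0 -> exists lam : R -> R, [/\
  forall v, lam (- v) = lam v,
  forall u v, lam u - lam v <= `|u - v|,
  forall t u v, 0 <= t <= 1 ->
    lam (t * u + (1 - t) * v) <= t * lam u + (1 - t) * lam v &
  forall w v, iidG G w -> {ae P, forall om,
    sublin (fun n => Smin (senv w om) n (Num.ceil (v * n%:R)) - lam v * n%:R)}].
Proof.
move=> iw0; have [C C0 conc] := @concentration R G d Omega P.
pose a n := projT1 (boolp.choice (conc n)).
have conc' n m := projT2 (boolp.choice (conc n)) m : forall w, iidG G w -> _.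
rewrite -/(a _) in conc'.
have [lam [h1 h2 h3 h4]] := time_constant C0
  (a_triangle HGsupp C0 conc' iw0) (a_lip HGsupp C0 conc' iw0)
  (a_mono HGsupp C0 conc' iw0) (a_opp HGsupp C0 conc' iw0) (a_lower HGsupp C0 conc' iw0).
exists lam; split => // w v iw.
exact (@Smin_ae_sublin _ _ _ _ _ HGsupp C C0 a conc' w v (lam v) iw (h1 v)).
Qed.

Lemma LambdaE w (lam : R -> R) : iidG G w -> (forall v, lam (- v) = lam v) ->
  (forall v, {ae P, forall om,
    sublin (fun n => Smin (senv w om) n (Num.ceil (v * n%:R)) - lam v * n%:R)}) ->
  Lambda w = lam.
Proof.
move=> iw even h; apply/funext => v; rewrite /Lambda.
have -> : lam v = lam `|v| by have [v0|v0] := leP 0 v; [rewrite ger0_norm|rewrite ltr0_norm// even].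
have conv : {ae P, forall om,
     (fun n : nat => Tpass (fun e => w e om) (0, 0) (endpt `|v| n) / n%:R)
       @ \oo --> lam `|v|}.
  have := iidG_nonneg HGsupp iw; apply: filterS2 (h `|v|) => om hs u0.
  have -> : (fun n : nat => Tpass (fun e => w e om) (0, 0) (endpt `|v| n) / n%:R) =
     (fun n => Smin (senv w om) n (Num.ceil (`|v| * n%:R)) / n%:R).
    by apply/funext => n; rewrite /endpt TpassE.
  exact: sublin_cvg.
rewrite /Lambda0; apply: xget_unique => // l hl.
(* Two almost sure limits agree at some outcome because the space is not null; hence the value
   picked by [xget] is [lam]. *)
have PT : (0 < P setT)%E by rewrite probability_setT lte01.
have : {ae P, forall om : Omega, l = lam `|v|}.
  apply: filterS2 hl conv => om; exact: cvg_unique.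
by move=> /(@filter_ex _ _ (ae_properfilter_algebraOfSetsType PT)) [].
Qed.

Lemma iidG_shear w sg : iidG G w ->
  iidG G (fun e => w (e.1, e.2 - sg * (e.1 + 1))).
Proof.
apply: (@iidG_reindex _ _ _ _ _ w _ (fun e => (e.1, e.2 + sg * (e.1 + 1)))).
by move=> [x y] /=; rewrite subrK.
Qed.

Lemma shear_bound w om (lam : R -> R) (v : R) (sg : int) (p : nat -> seq pt2) : wnneg (senv w om) ->
  (forall n, [/\ semi_directed (p n), uniq (p n)
      & geodesic (senv w om) (0, 0) (endpt v n) (p n)]) ->
  sublin (fun n => Smin (senv w om) n (Num.ceil (v * n%:R)) - lam v * n%:R) ->
  sublin (fun n => Smin (senv (fun e => w (e.1, e.2 - sg * (e.1 + 1))) om) n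
    (Num.ceil ((v + sg%:~R) * n%:R)) - lam (v + sg%:~R) * n%:R) ->
  exists2 e : nat -> R, sublin e & forall n, (lam (v + sg%:~R) - lam v) * n%:R <=
  \sum_(k < n.+1) (idist R (fpio (p n) n (Num.ceil (v * n%:R)) k.+1 + sg)
                      (fpio (p n) n (Num.ceil (v * n%:R)) k) -
                   idist R (fpio (p n) n (Num.ceil (v * n%:R)) k.+1)
                      (fpio (p n) n (Num.ceil (v * n%:R)) k)) + e n.
Proof.
move=> u0 hp s1 s2; set w' := (fun e => w _) in s2.
exists (fun n => (Smin (senv w om) n (Num.ceil (v * n%:R)) - lam v * n%:R) -
   (Smin (senv w' om) n (Num.ceil ((v + sg%:~R) * n%:R)) - lam (v + sg%:~R) * n%:R) +
   (2 + `|sg|%:~R)).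
  by apply: sublinD (sublin_cst _); apply: sublinD => //; exact: sublinN.
move=> n; have [sd _ [pp pt]] := hp n.
have := Smin_shear sg u0 sd pp; rewrite pt /endpt TpassE//.
have -> : wshear sg (senv w om) = senv w' om by [].
have u0' : wnneg (senv w' om) by move=> e; exact: u0.
have := Smin_lip u0' n (Num.ceil (v * n%:R) + sg * n.+1%:Z) (Num.ceil ((v + sg%:~R) * n%:R)).
(* The shear moves the endpoint by [n + 1] units instead of [n]: this costs [|sg|], the two ceilings
   at most 2. *)
have : idist R (Num.ceil ((v + sg%:~R) * n%:R)) (Num.ceil (v * n%:R) + sg * n.+1%:Z) <= 2 + `|sg|%:~R.
  rewrite idistE intrD intrM -[n.+1%:Z%:~R]/(n.+1%:R) -natr1.
  have := ceil_dist ((v + sg%:~R) * n%:R); have := ceil_dist (v * n%:R).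
  rewrite intr_norm; have := ler_norm (sg%:~R : R); have := ler_norm (- (sg%:~R : R)).
  rewrite normrN !ler_norml.
  set x := (Num.ceil _)%:~R; set y := (Num.ceil _)%:~R; set z := sg%:~R; lra.
set S := \sum_(k < n.+1) _; rewrite mulrBl; lra.
Qed.

End Main.

Theorem theorem2p7 (R : realType) (G : probability R R)
  (d : measure_display) (Omega : measurableType d) (P : probability Omega R)
  (w : pt2 -> {RV P >-> R})
  (HGsupp : G [set x : R | 0 <= x] = 1%E)
  (HGnondet : ~ (exists c : R, forall A : set R, measurable A -> G A = \d_c A))
  (Hlaw : forall e : pt2, forall A : set R, measurable A ->
            distribution P (w e) A = G A)
  (Hindep : mutually_indep w)
  (v : R) (Hv : 0 <= v)
  (gamma : nat -> Omega -> seq pt2)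
  (Hgamma : {ae P, forall om, forall n : nat,
      [/\ semi_directed (gamma n om), uniq (gamma n om)
        & geodesic (fun e => w e om) (0, 0) (endpt v n) (gamma n om)]}) :
  {ae P, forall om,
    let p n := gamma n om in
    let m n := Num.ceil (v * n%:R) in
    ((dplus (Lambda w) v)%:E <=
       limn_einf (fun n : nat =>
         (((Ucnt (p n) n (m n))%:R + (Rcnt (p n) n (m n))%:R
            - (Dcnt (p n) n (m n))%:R) / n%:R)%:E))%E /\
    ((dminus (Lambda w) v)%:E >=
       limn_esup (fun n : nat =>
         (((Ucnt (p n) n (m n))%:R - (Rcnt (p n) n (m n))%:R
            - (Dcnt (p n) n (m n))%:R) / n%:R)%:E))%E}.
Proof.
have iw : iidG G w by split.
have [lam [even lip cvx ael]] := ae_time_constant HGsupp iw.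
rewrite (LambdaE HGsupp iw even (fun v => ael w v iw)).
have nn := iidG_nonneg HGsupp iw.
have h0 := ael w v iw.
have hp := ael _ (v + 1%:~R) (iidG_shear 1 iw).
have hm := ael _ (v + (-1)%:~R) (iidG_shear (-1) iw).
near=> om; pose p n := gamma n om; pose m (n : nat) := Num.ceil (v * n%:R).
have s0 : sublin (fun n => Smin (senv w om) n (Num.ceil (v * n%:R)) - lam v * n%:R).
  by near: om.
have sp : sublin (fun n => Smin (senv (fun e => w (e.1, e.2 - 1 * (e.1 + 1))) om) n
    (Num.ceil ((v + 1%:~R) * n%:R)) - lam (v + 1%:~R) * n%:R) by near: om.
have sm : sublin (fun n => Smin (senv (fun e => w (e.1, e.2 - -1 * (e.1 + 1))) om) n
    (Num.ceil ((v + (-1)%:~R) * n%:R)) - lam (v + (-1)%:~R) * n%:R) by near: om.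
have u0 : wnneg (senv w om) by near: om.
have gam : forall n, [/\ semi_directed (p n), uniq (p n)
      & geodesic (senv w om) (0, 0) (endpt v n) (p n)].
  by rewrite /p /senv; near: om.
split.
  apply: (@le_trans _ _ (lam (v + 1%:~R) - lam v)%:E).
    by rewrite lee_fin; exact: dplus_le.
  have [e he hX] := @shear_bound _ _ _ P w om lam v 1 p u0 gam s0 sp.
  apply: limn_einf_sublin he _ => n; rewrite -sum_idist_up; exact: hX.
(* The upper limit becomes the lower limit of the negated sequence, which is what the downward shear
   controls. *)
rewrite -leeN2 -limn_einfN.
apply: (@le_trans _ _ (lam (v + (-1)%:~R) - lam v)%:E).
  rewrite -EFinN lee_fin lerNl opprB.
  have -> : (-1)%:~R = -1 :> R by []. exact: dminus_ge.
have [e he hX] := @shear_bound _ _ _ P w om lam v (-1) p u0 gam s0 sm.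
apply: (@le_trans _ _ (limn_einf (fun n : nat => (- ((Ucnt (p n) n (m n))%:R -
    (Rcnt (p n) n (m n))%:R - (Dcnt (p n) n (m n))%:R) / n%:R : R)%:E))).
  by apply: limn_einf_sublin he _ => n; rewrite -sum_idist_down; exact: hX.
rewrite le_eqVlt; apply/orP; left; apply/eqP; congr limn_einf.
by apply/funext => n /=; rewrite mulNr.
Unshelve. all: by end_near. Qed.
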